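(* Let $E\subseteq F$ be aperiodic countable Borel equivalence relations on a Polish space $X$. Then there is a comeager $F$-invariant Borel set $C\subseteq X$ such that $E\upharpoonright C$ is compressible.
   Context: A countable Borel equivalence relation (CBER) on $X$ is a Borel equivalence relation with countable classes; it is aperiodic if all classes are infinite. A CBER $E$ on $Y$ is compressible if there is a Borel injection $T:Y\to Y$ with $T([y]_E)\subsetneq[y]_E$ for every $y$. A set $C$ is $F$-invariant if it is a union of $F$-classes. *)

(* Defs.v *)
From HB Require Import structures.
From mathcomp Require Import all_boot all_order all_algebra.
From mathcomp Require Import all_classical all_reals.
From mathcomp Require Import topology measurable_structure.

Set Implicit Arguments.
Unset Strict Implicit.
Unset Printing Implicit Defensive.

Import Order.TTheory GRing.Theory Num.Theory.

Local Open Scope classical_set_scope.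
Local Open Scope ring_scope.

Definition is_metric (R : realType) (X : Type) (d : X -> X -> R) : Prop :=
  [/\ forall x y, d x y = 0 <-> x = y,
      forall x y, d x y = d y x
    & forall x y z, d x z <= d x y + d y z].

Definition metric_compatible (R : realType) (X : topologicalType)
    (d : X -> X -> R) : Prop :=
  forall (x : X) (A : set X),
    nbhs x A <-> exists2 e : R, 0 < e & [set y | d x y < e] `<=` A.

Definition cauchy_sequence (R : realType) (X : Type) (d : X -> X -> R)
    (u : nat -> X) : Prop :=
  forall e : R, 0 < e ->
    exists N : nat, forall m n, (N <= m)%N -> (N <= n)%N -> d (u m) (u n) < e.

Definition completely_metrizable (R : realType) (X : topologicalType) : Prop :=
  exists d : X -> X -> R,
    [/\ is_metric d, metric_compatible d
      & forall u : nat -> X,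
          cauchy_sequence d u -> exists x : X, u @ \oo --> x].

Definition separable_space (X : topologicalType) : Prop :=
  exists2 D : set X, countable D & dense D.

(* [X] carries no distinguished metric, and may be empty. *)
Definition polish_space (R : realType) (X : topologicalType) : Prop :=
  separable_space X /\ completely_metrizable R X.

Definition nowhere_dense (X : topologicalType) (A : set X) : Prop :=
  interior (closure A) = set0.

Definition meager (X : topologicalType) (A : set X) : Prop :=
  exists2 N : nat -> set X, (forall n, nowhere_dense (N n))
    & A = \bigcup_n N n.

Definition comeager (X : topologicalType) (A : set X) : Prop := meager (~` A).

Definition borel (X : topologicalType) : set (set X) := <<s @open X >>.

Definition borel_fun (X Y : topologicalType) (f : X -> Y) : Prop :=
  forall B : set Y, borel B -> borel (f @^-1` B).

Definition eqclass (X : Type) (E : set (X * X)) (x : X) : set X :=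
  [set y | E (x, y)].

Definition equivalence (X : Type) (E : set (X * X)) : Prop :=
  [/\ forall x, E (x, x),
      forall x y, E (x, y) -> E (y, x)
    & forall x y z, E (x, y) -> E (y, z) -> E (x, z)].

(* [borel E] refers to the product topology on [X * X]. *)
Definition cber (X : topologicalType) (E : set (X * X)) : Prop :=
  [/\ borel E, equivalence E & forall x, countable (eqclass E x)].

Definition aperiodic (X : Type) (E : set (X * X)) : Prop :=
  forall x, infinite_set (eqclass E x).

Definition invariant_set (X : Type) (F : set (X * X)) (C : set X) : Prop :=
  exists A : set X, C = \bigcup_(x in A) eqclass F x.

(* The relation E|C lives on the subtype [set_type C], which carries the
   subspace topology; its Borel sets are the traces on [C] of those of [X]. *)
Definition restriction (X : Type) (E : set (X * X)) (C : set X) :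
    set (set_type C * set_type C) :=
  [set p | E (set_val p.1, set_val p.2)].
Arguments restriction {X} E C.

Definition compressible (Y : topologicalType) (E : set (Y * Y)) : Prop :=
  exists T : Y -> Y,
    [/\ borel_fun T, injective T
      & forall y, T @` eqclass E y `<` eqclass E y].

(* Main.v *)
(* Suppose that Borel functions enumerate the classes of [F]. Cut each
   [E]-class into a decreasing sequence of infinite Borel markers with at
   most one common point, and let a point that leaves the sequence at step [n]
   be sent by [pi] to its [g n]-th [F]-neighbour, if this is an [E]-neighbour.
   Any finite part of [g] leaves infinitely many points of each class undecided,
   so for a fixed point [y] a generic [g] gives [y] an infinite [pi]-fibre, and
   a Kuratowski-Ulam argument yields one [g] that works for all points of
   residually many [F]-classes. The map sending each point to the next one in
   its [pi]-fibre then compresses [E].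

   Enumerating [F] needs only a weak form of the Luzin-Novikov theorem. A Baire
   category argument on a closed presentation of [F] gives Borel functions
   enumerating the classes of the points of some dense G_delta set [D]. The
   saturation of [D] is Borel, with a Borel retraction to [D], because each of
   these functions is injective on countably many Borel pieces whose images
   cover its range: the fibres in [D] are countable and closed in [D], hence
   have isolated points. Borel inverses of injective Borel functions come from
   Lusin separation. *)

Require Import Defs.
From mathcomp Require Import all_boot all_order all_algebra.
From mathcomp Require Import all_classical all_reals.
From mathcomp Require Import topology measurable_structure.
From mathcomp Require Import lra.

Set Implicit Arguments.
Unset Strict Implicit.
Unset Printing Implicit Defensive.

Import Order.TTheory GRing.Theory Num.Theory.

Local Open Scope classical_set_scope.
Local Open Scope ring_scope.

(** * Closure properties of Borel sets and Borel functions *)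

Section BorelCalculus.
Variable X : topologicalType.
Implicit Types A B : set X.

Lemma borel_open A : open A -> borel A.
Proof. exact: sub_sigma_algebra. Qed.

Lemma borel_not A : borel A -> borel [set x | ~ A x].
Proof. by move=> /sigma_algebraCD; rewrite setTD. Qed.

Lemma borel_const (P : Prop) : borel [set x : X | P].
Proof.
have [p|np] := pselect P.
  by rewrite (_ : mkset _ = setT);
    [apply: borel_open; exact: openT | apply/seteqP; split].
by rewrite (_ : mkset _ = set0); [exact: sigma_algebra0 | apply/seteqP; split].
Qed.

Lemma borel_bigcup (G : nat -> set X) : (forall n, borel (G n)) ->
  borel (\bigcup_n G n).
Proof. by have [_ _] := smallest_sigma_algebra setT (@open X); apply. Qed.

Lemma borel0 : borel (@set0 X).
Proof. exact: sigma_algebra0. Qed.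

Lemma borel_ex (I : countType) (P : I -> set X) :
  (forall i, borel (P i)) -> borel [set x | exists i, P i x].
Proof.
move=> bP.
pose Q n : set X := if unpickle n is Some i then P i else set0.
have -> : [set x | exists i, P i x] = \bigcup_n Q n.
  apply/seteqP; split=> x /=; first by move=> [i Pi]; exists (pickle i);
    rewrite ///Q pickleK.
  by move=> [n _]; rewrite /Q; case: (unpickle n) => // i Pi; exists i.
apply: borel_bigcup => n; rewrite /Q; case: (unpickle n) => //.
exact: borel0.
Qed.

Lemma borel_all (I : countType) (P : I -> set X) :
  (forall i, borel (P i)) -> borel [set x | forall i, P i x].
Proof.
move=> bP; rewrite (_ : mkset _ = [set x | ~ exists i, ~ P i x]).
  by apply: borel_not; apply: borel_ex => i; exact: borel_not.
apply/seteqP; split=> x /= h; first by move=> [i]; apply.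
by move=> i; apply: contrapT => n; apply: h; exists i.
Qed.

Lemma borel_or A B : borel A -> borel B -> borel [set x | A x \/ B x].
Proof.
move=> bA bB.
rewrite (_ : mkset _ = [set x | exists b, (if b then A else B) x]).
  by apply: borel_ex => -[].
apply/seteqP; split=> x /=; first by case=> h; [exists true|exists false].
by move=> [[] h]; [left|right].
Qed.

Lemma borel_and A B : borel A -> borel B -> borel [set x | A x /\ B x].
Proof.
move=> bA bB.
rewrite (_ : mkset _ = [set x | forall b, (if b then A else B) x]).
  by apply: borel_all => -[].
apply/seteqP; split=> x /=; first by move=> [h1 h2] [].
by move=> h; split; [exact: (h true)|exact: (h false)].
Qed.

Lemma borel_imply A B : borel A -> borel B -> borel [set x | A x -> B x].
Proof.
move=> bA bB; rewrite (_ : mkset _ = [set x | ~ A x \/ B x]).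
  by apply: borel_or => //; exact: borel_not.
apply/seteqP; split=> x /=; last by case.
by move=> h; have [a|a] := pselect (A x); [right; exact: h|left].
Qed.

Lemma borel_id : borel_fun (@id X).
Proof. by []. Qed.

Lemma borel_comp (Y : topologicalType) (f : X -> Y) (A : set Y) :
  borel_fun f -> borel A -> borel [set x | A (f x)].
Proof. by move=> bf /bf. Qed.

Lemma borel_fun_comp (Y Z : topologicalType) (f : Y -> Z) (g : X -> Y) :
  borel_fun f -> borel_fun g ->
  borel_fun (fun x => f (g x)).
Proof. by move=> bf bg B /bf /bg. Qed.

Lemma borel_fun_glue (I : countType) (P : I -> set X) (h : I -> X -> X)
    (T : X -> X) :
  (forall i, borel (P i)) -> (forall i, borel_fun (h i)) ->
  (forall x, exists i, P i x) -> (forall i x, P i x -> T x = h i x) ->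
  borel_fun T.
Proof.
move=> bP bh cov eqT B bB.
rewrite (_ : _ @^-1` _ = [set x | exists i, P i x /\ B (h i x)]).
  by apply: borel_ex => i; apply: borel_and => //; exact: borel_comp.
apply/seteqP; split=> x /=.
  by move=> BT; have [i Pi] := cov x; exists i; rewrite -(eqT _ _ Pi).
by move=> [i [Pi]]; rewrite -(eqT _ _ Pi).
Qed.

Lemma borel_fun_open (Y : topologicalType) (f : X -> Y) :
  (forall O, open O -> borel (f @^-1` O)) -> borel_fun f.
Proof.
move=> fO B; apply: (smallest_sub _ _ (X := [set B | borel (f @^-1` B)])).
  split=> //=.
  - by rewrite preimage_set0; exact: sigma_algebra0.
  - by move=> A bA; rewrite setTD preimage_setC; exact: borel_not.
  - by move=> G bG; rewrite preimage_bigcup; exact: borel_bigcup.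
by move=> O; exact: fO.
Qed.

(** Taking the first suitable index in the order given by [pickle] makes the choice Borel. *)
Lemma borel_select (I : countType) (P : I -> set X) :
  (forall i, borel (P i)) -> (forall x, exists i, P i x) ->
  exists2 N : X -> I, forall x, P (N x) x & forall i, borel [set x | N x = i].
Proof.
move=> bP cov.
pose first i x := P i x /\ forall j, ((pickle j < pickle i)%N : Prop) -> ~ P j x.
have first_ex x : exists i, first i x.
  have : exists n, exists2 i, pickle i = n & P i x.
    by have [i Pi] := cov x; exists (pickle i), i.
  move=> [n]; elim/ltn_ind: n => n IH [i ni Pi].
  have [[j [jn Pj]]|no] := pselect (exists j, (pickle j < n)%N /\ P j x).
    by apply: (IH _ jn); exists j.
  exists i; split=> // j; rewrite ni => jn Pj; apply: no.
  by exists j.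
have first_uniq x i j : first i x -> first j x -> i = j.
  move=> [Pi hi] [Pj hj]; apply: (pcan_inj (@pickleK I)).
  case: (ltngtP (pickle i) (pickle j)) => // ij; first by case: (hj _ ij).
  by case: (hi _ ij).
have /choice [N NP] := first_ex.
exists N; first by move=> x; have [] := NP x.
move=> i; rewrite (_ : mkset _ = [set x | first i x]).
  apply: borel_and => //; apply: borel_all => j; apply: borel_imply.
    exact: borel_const.
  exact: borel_not.
apply/seteqP; split=> x /=; first by move=> <-; exact: NP.
by move=> fx; exact: (first_uniq x _ _ (NP x) fx).
Qed.

Lemma borel_fun_select (I : countType) (N : X -> I) (h : I -> X -> X) :
  (forall i, borel [set x | N x = i]) -> (forall i, borel_fun (h i)) ->
  borel_fun (fun x => h (N x) x).
Proof.
move=> bN bh; apply: (borel_fun_glue bN bh); first by move=> x; exists (N x).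
by move=> i x /= ->.
Qed.

End BorelCalculus.

(** * Polish spaces with a chosen metric and dense sequence *)

Section PolishData.
Variables (R : realType) (X : topologicalType).

Record polish_data := PolishData {
  pdist : X -> X -> R;
  pseq : nat -> X;
  pdist_metric : is_metric pdist;
  pdist_compat : metric_compatible pdist;
  pdist_complete : forall u, cauchy_sequence pdist u ->
    exists x : X, u @ \oo --> x;
  pseq_dense : forall x (e : R), 0 < e -> exists k, pdist (pseq k) x < e }.

Lemma polish_data_exists (x0 : X) : polish_space R X -> inhabited polish_data.
Proof.
move=> [[D cD dD] [d [md cd compd]]].
have [[d0 dsym dtri]] := (md, tt).
have /countable_injP [f finj] := cD.
(* The sequence inverts the injection [f] of [D] into the integers; integers outside its range are
   sent to the default point [x0]. *)
have /choice [s sP] : forall n, exists sn, forall y, D y -> f y = n -> sn = y.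
  move=> n; have [[y [yD fy]]|no] := pselect (exists y, D y /\ f y = n).
    by exists y => z zD fz; apply: finj; rewrite ?inE// fy fz.
  by exists x0 => y yD fy; exfalso; apply: no; exists y.
constructor; apply: (@PolishData d s) => // x e e0.
have [|y [xy Dy]] := dD [set y | d x y < e]^° _ (@open_interior _ _).
  by exists x; rewrite /interior/=; apply/cd; exists e.
exists (f y); rewrite (sP _ y Dy erefl) dsym.
exact: (@interior_subset _ _ _ xy).
Qed.
End PolishData.

(** * Metric and analytic sets *)

Section Eps.
Variable R : realType.

Definition eps (n : nat) : R := n.+1%:R^-1.

Lemma eps_gt0 n : 0 < eps n.
Proof. by rewrite invr_gt0 ltr0n. Qed.

Lemma eps_small (e : R) : 0 < e -> exists n, forall m, (n <= m)%N -> eps m < e.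
Proof.
move=> e0; exists (Num.trunc e^-1) => m nm.
rewrite -[ltRHS]invrK ltf_pV2 ?posrE ?invr_gt0 ?ltr0n//.
have := truncnS_gt e^-1; move/lt_le_trans; apply.
by rewrite ler_nat ltnS.
Qed.

End Eps.
Arguments eps {R} n.

Section Metric.
Variables (R : realType) (X : topologicalType) (S : polish_data R X).
Local Notation d := (pdist S).

Lemma dist_xx x : d x x = 0.
Proof. by case: (pdist_metric S) => h _ _; apply/h. Qed.

Lemma dist_eq0 x y : d x y = 0 -> x = y.
Proof. by case: (pdist_metric S) => h _ _; move/h. Qed.

Lemma dist_sym x y : d x y = d y x.
Proof. by case: (pdist_metric S). Qed.

Lemma dist_tri x y z : d x z <= d x y + d y z.
Proof. by case: (pdist_metric S). Qed.

Lemma dist_ge0 x y : 0 <= d x y.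
Proof. have := dist_tri x y x; rewrite dist_xx (dist_sym y); lra. Qed.

Lemma dist_gt0 x y : x <> y -> 0 < d x y.
Proof.
move=> xy; rewrite lt_neqAle dist_ge0 andbT eq_sym.
by apply/eqP => /dist_eq0.
Qed.

Lemma open_dist (A : set X) x : open A -> A x ->
  exists2 e : R, 0 < e & forall y, d x y < e -> A y.
Proof. by move=> oA Ax; apply/(pdist_compat S); exact: open_nbhs_nbhs. Qed.

Lemma dist_open (A : set X) :
  (forall x, A x -> exists2 e : R, 0 < e & forall y, d x y < e -> A y) ->
  open A.
Proof. by move=> h; rewrite openE => x /h ?; apply/(pdist_compat S). Qed.

Definition basic (i : nat * nat) : set X :=
  [set y | d (pseq S i.1) y < eps i.2].

Lemma basic_open i : open (basic i).
Proof.
apply: dist_open => x; rewrite /basic/= => h.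
exists (eps i.2 - d (pseq S i.1) x); first by rewrite subr_gt0.
by move=> y; have := dist_tri (pseq S i.1) x y; lra.
Qed.

Lemma basic_inh i : basic i (pseq S i.1).
Proof. by rewrite /basic/= dist_xx eps_gt0. Qed.

Lemma basic_small x n : exists k, basic (k, n) x.
Proof. by have [k ?] := pseq_dense S x (eps_gt0 R n); exists k. Qed.

Lemma basic_nbhs (A : set X) x : open A -> A x ->
  exists i, basic i x /\ basic i `<=` A.
Proof.
move=> oA Ax; have [e e0 eA] := open_dist oA Ax.
have [n hn] := @eps_small _ (e / 2) ltac:(lra).
have [k hk] := basic_small x n.
exists (k, n); split=> // y; move: hk; rewrite /basic/= => hk hy; apply: eA.
have := dist_tri x (pseq S k) y; rewrite (dist_sym x (pseq S k)).
by have := hn n (leqnn _); lra.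
Qed.

Lemma borel_cball x e : borel [set y | d x y <= e].
Proof.
rewrite (_ : mkset _ = [set y | ~ e < d x y]).
  apply: borel_not; apply: borel_open; apply: dist_open => y /= h.
  exists (d x y - e); first by rewrite subr_gt0.
  by move=> z; have := dist_tri x z y; rewrite (dist_sym z); lra.
by apply/seteqP; split=> y /=; rewrite leNgt => /negP.
Qed.

Lemma borel_basic i : borel (basic i).
Proof. by apply: borel_open; exact: basic_open. Qed.

Definition converges (u : nat -> X) (x : X) : Prop :=
  forall e : R, 0 < e -> exists N, forall n, (N <= n)%N -> d (u n) x < e.

Lemma complete_converges u : cauchy_sequence d u -> exists x, converges u x.
Proof.
move=> /(pdist_complete (p := S)) [x ux]; exists x => e e0.
have /ux [N _ hN] : nbhs x [set y | d x y < e].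
  by apply/(pdist_compat S); exists e.
by exists N => n /hN /=; rewrite dist_sym.
Qed.

(** The countably many basic sets separate points, so equality amounts to [g x] lying in each basic
    set that contains [f x]. *)
Lemma borel_eq (Y : topologicalType) (f g : Y -> X) : borel_fun f -> borel_fun g ->
  borel [set x | f x = g x].
Proof.
move=> bf bg.
rewrite (_ : mkset _ = [set x | forall i, basic i (f x) -> basic i (g x)]).
  apply: borel_all => i; apply: borel_imply;
    by apply: borel_comp => //; exact: borel_basic.
apply/seteqP; split=> x /=; first by move->.
move=> h; apply: contrapT => /dist_gt0 fg.
have [n hn] := @eps_small _ (d (f x) (g x) / 2) ltac:(lra).
have [k hk] := basic_small (f x) n; have := h _ hk.
move: hk; rewrite /basic/=; have := hn n (leqnn _).
have := dist_tri (f x) (pseq S k) (g x); rewrite (dist_sym (f x) (pseq S k)).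
lra.
Qed.

(** By second countability an open subset of the product is a countable union of basic rectangles,
    and rectangles pull back to Borel sets. *)
Lemma borel_pair (f g : X -> X) (P : set (X * X)) : borel_fun f ->
  borel_fun g -> borel P -> borel [set x | P (f x, g x)].
Proof.
move=> bf bg.
apply: (smallest_sub _ _ (X := [set P | borel [set x | P (f x, g x)]])).
  split=> /=.
  - exact: borel0.
  - move=> A bA; rewrite (_ : mkset _ = [set x | ~ A (f x, g x)]).
      exact: borel_not.
    by apply/seteqP; split=> x /=; [case|split].
  - move=> G bG; rewrite (_ : mkset _ = \bigcup_n [set x | G n (f x, g x)]) //.
    exact: borel_bigcup.
move=> O /= oO.
rewrite (_ : mkset _ = [set x | exists i : (nat * nat) * (nat * nat),
  (basic i.1 `*` basic i.2 `<=` O) /\ (basic i.1 (f x) /\ basic i.2 (g x))]).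
  apply: borel_ex => i; apply: borel_and; first exact: borel_const.
  by apply: borel_and; apply: borel_comp => //; exact: borel_basic.
apply/seteqP; split=> x /=; last by move=> [i [h [? ?]]]; exact: h.
move=> Ofg; have : nbhs (f x, g x) O by exact: open_nbhs_nbhs.
move=> [[U V] /= [nU nV] UV].
have [i [i1 i2]] := basic_nbhs (@open_interior _ U) nU.
have [j [j1 j2]] := basic_nbhs (@open_interior _ V) nV.
exists (i, j); split=> // -[a b] [/= ha hb]; apply: UV; split=> /=.
  by apply: interior_subset; exact: i2.
by apply: interior_subset; exact: j2.
Qed.

Definition dist2 (p q : X * X) : R := Num.max (d p.1 q.1) (d p.2 q.2).

Lemma dist2_xx p : dist2 p p = 0.
Proof. by rewrite /dist2 !dist_xx maxxx. Qed.

Lemma dist2_sym p q : dist2 p q = dist2 q p.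
Proof. by rewrite /dist2 dist_sym [d p.2 _]dist_sym. Qed.

Lemma dist2_tri p q r : dist2 p r <= dist2 p q + dist2 q r.
Proof.
rewrite /dist2 ge_max; apply/andP; split.
  apply: le_trans (dist_tri _ q.1 _) _.
  by apply: lerD; rewrite le_max lexx.
apply: le_trans (dist_tri _ q.2 _) _.
by apply: lerD; rewrite le_max lexx orbT.
Qed.

Lemma open_dist2 (A : set (X * X)) p : open A -> A p ->
  exists2 e : R, 0 < e & forall q, dist2 p q < e -> A q.
Proof.
move=> oA Ap; have : nbhs p A by exact: open_nbhs_nbhs.
move=> [[U V] /= [/(pdist_compat S) [e1 e10 U1] /(pdist_compat S) [e2 e20 V1]] UV].
exists (Num.min e1 e2); first by rewrite lt_min e10.
move=> q; rewrite /dist2 gt_max !lt_min => /andP [/andP [a _] /andP [_ b]].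
by apply: UV; split; [exact: U1|exact: V1].
Qed.

End Metric.

(** * Analytic sets as projections of closed sets, for the metrics of [X] and of [X * X] *)

Section Analytic.
Variables (R : realType) (Y : topologicalType) (d : Y -> Y -> R).
Hypothesis dxx : forall x, d x x = 0.
Hypothesis dsym : forall x y, d x y = d y x.
Hypothesis dtri : forall x y z, d x z <= d x y + d y z.
Hypothesis dopen : forall (A : set Y) p, open A -> A p ->
  exists2 e : R, 0 < e & forall q, d p q < e -> A q.

Definition agree (n : nat) (s t : nat -> nat) : Prop :=
  forall i, (i < n)%N -> s i = t i.

(* [K] is closed in the product of [Y] with the Baire space. *)
Definition kclosed (K : Y -> (nat -> nat) -> Prop) : Prop :=
  forall y s, (forall (e : R) n, 0 < e -> exists z t,
    [/\ d y z < e, agree n s t & K z t]) -> K y s.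

Definition analytic (A : set Y) : Prop :=
  exists2 K, kclosed K & forall y, A y <-> exists s, K y s.

(** The first entry of a branch names the set of the family, and the remaining entries form a
    witness for it. *)
Lemma analytic_bigcup (A : nat -> set Y) :
  (forall n, analytic (A n)) -> analytic (\bigcup_n A n).
Proof.
move=> /(_ _)/cid2-/all_sig2 [K Kc KA].
exists (fun y s => K (s 0%N) y (fun i => s i.+1)).
  move=> y s h; apply: Kc => e n e0.
  have [z [t [yz st Kt]]] := h e n.+1 e0.
  exists z, (fun i => t i.+1); split=> //; last by rewrite (st 0%N).
  by move=> i ni; exact: st.
move=> y; split=> [[n _ /KA [s Ks]]|[s Ks]].
  by exists (fun i => if i is j.+1 then s j else n).
by exists (s 0%N) => //; apply/KA; eexists; exact: Ks.
Qed.

(** A single branch carries witnesses for all sets of the family, interleaved by a pairing of the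
    integers. *)
Lemma analytic_bigcap (A : nat -> set Y) :
  (forall n, analytic (A n)) -> analytic (\bigcap_n A n).
Proof.
move=> /(_ _)/cid2-/all_sig2 [K Kc KA].
exists (fun y s => forall n, K n y (fun i => s (pickle (n, i)))).
  move=> y s h m; apply: Kc => e n e0.
  have [z [t [yz st Kt]]] := h e (\max_(i < n) pickle (m, i : nat)).+1 e0.
  exists z, (fun i => t (pickle (m, i))); split=> // i ni; apply: st.
  by rewrite ltnS; exact: (@leq_bigmax _ _ (Ordinal ni)).
move=> y; split=> [h|[s Ks] n _]; last by apply/KA; eexists; exact: Ks.
have /choice [f fP] : forall n, exists s, K n y s by move=> n; apply/KA; exact: h.
exists (fun k => if unpickle k is Some (n, i) then f n i else 0%N) => n.
rewrite (_ : (fun i => _) = f n)//.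
by apply/funext => i; rewrite pickleK.
Qed.

Lemma analytic_closed (A : set Y) :
  (forall y, (forall e : R, 0 < e -> exists2 z, d y z < e & A z) -> A y) ->
  analytic A.
Proof.
move=> Ac; exists (fun y _ => A y).
  move=> y s h; apply: Ac => e e0.
  by have [z [t [? _ ?]]] := h e 0%N e0; exists z.
by move=> y; split=> [|[]//]; exists (fun=> 0%N).
Qed.

Lemma analytic_open (A : set Y) : open A -> analytic A.
Proof.
move=> oA.
(* An open set is a countable union of closed sets: those of the points at distance at least [eps n]
   from its complement. *)
rewrite (_ : A = \bigcup_n [set y | forall z, d y z < eps n -> A z]).
  apply: analytic_bigcup => n; apply: analytic_closed => y h z yz.
  have [w yw] := h (eps n - d y z) ltac:(by rewrite subr_gt0).
  by apply; have := dtri w y z; rewrite (dsym w y); lra.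
apply/seteqP; split=> y /=.
  move=> /(dopen oA) [e e0 eA]; have [n hn] := eps_small e0.
  by exists n => // z yz; apply: eA; apply: lt_trans yz (hn _ _).
move=> [n _]; apply.
by rewrite dxx eps_gt0.
Qed.

Lemma borel_analytic (A : set Y) : borel A -> analytic A.
Proof.
(* Complements of analytic sets need not be analytic, so the induction carries both a set and its
   complement. *)
suff: @borel Y `<=` [set A | analytic A /\ analytic (~` A)] by move=> h /h [].
apply: smallest_sub; first split=> /=.
- split; last by rewrite setC0; apply: analytic_open; exact: openT.
  by apply: analytic_open; exact: open0.
- by move=> B [B1 B2]; rewrite setTD setCK.
- move=> G hG; split; first by apply: analytic_bigcup => n; case: (hG n).
  by rewrite setC_bigcup; apply: analytic_bigcap => n; case: (hG n).
move=> B oB /=; split; first exact: analytic_open.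
apply: analytic_closed => y h By.
have [e e0 eB] := dopen oB By; have [z /eB Bz] := h e e0.
by apply.
Qed.

End Analytic.

(** * Coding of points by sequences of integers *)

Section Coding.
Variables (R : realType) (X : topologicalType) (S : polish_data R X).
Local Notation d := (pdist S).

Lemma borel_analytic1 (A : set X) : borel A -> analytic d A.
Proof.
apply: borel_analytic; [exact: dist_xx|exact: dist_sym|exact: dist_tri|].
exact: open_dist.
Qed.

Lemma borel_analytic2 (A : set (X * X)) : borel A -> analytic (dist2 S) A.
Proof.
apply: borel_analytic; [exact: dist2_xx|exact: dist2_sym|exact: dist2_tri|].
exact: open_dist2.
Qed.

(* The even entries of [s] code a point as the limit of a fast Cauchy sequence
   of elements of the dense sequence; the odd entries are left free. *)
Definition codes (s : nat -> nat) (y : X) : Prop :=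
  forall i, d (pseq S (s i.*2)) y <= eps i.

Definition codes_upto (n : nat) (s : nat -> nat) (y : X) : Prop :=
  forall i, (i.*2 < n)%N -> d (pseq S (s i.*2)) y <= eps i.

Lemma agree_sym n s t : agree n s t -> agree n t s.
Proof. by move=> h i /h. Qed.

Lemma codes_upto_agree n s t y :
  agree n s t -> codes_upto n s y -> codes_upto n t y.
Proof. by move=> st h i ni; rewrite -st//; exact: h. Qed.

Lemma codes_codes_upto n s y : codes s y -> codes_upto n s y.
Proof. by move=> h i _. Qed.

Lemma codes_ex y (t : nat -> nat) :
  exists2 s, codes s y & forall k, s k.*2.+1 = t k.
Proof.
have /choice [f fP] n := pseq_dense S y (eps_gt0 R n).
exists (fun k => if odd k then t k./2 else f k./2) => i.
  by rewrite odd_double doubleK ltW.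
by rewrite /= odd_double/= uphalf_double.
Qed.

Lemma codes_upto_near i n s y z : (i.*2 < n)%N ->
  codes_upto n s y -> codes_upto n s z -> d y z <= 2 * eps i.
Proof.
move=> ni /(_ _ ni) hy /(_ _ ni) hz.
have := dist_tri S y (pseq S (s i.*2)) z; rewrite (dist_sym S y (pseq _ _)); lra.
Qed.

Lemma codes_inj s y z : codes s y -> codes s z -> y = z.
Proof.
move=> hy hz; apply: contrapT => /(dist_gt0 S) yz.
have [n hn] := @eps_small _ (d y z / 2) ltac:(lra).
have := codes_upto_near (ltnSn n.*2) (codes_codes_upto hy)
  (codes_codes_upto hz).
by have := hn n (leqnn _); lra.
Qed.

Lemma codes_limit s (a : nat -> X) : (forall n, codes_upto n s (a n)) ->
  exists2 y, codes s y & converges S a y.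
Proof.
move=> ha.
have [y ay] : exists y, converges S a y.
  apply: complete_converges => e e0.
  have [i hi] := @eps_small _ (e / 2) ltac:(lra).
  exists i.*2.+1 => m n im jn; have := hi i (leqnn _).
  suff: d (a m) (a n) <= 2 * eps i by lra.
  apply: (@codes_upto_near i i.*2.+1 s) => // j ji; apply: ha;
    exact: leq_trans ji _.
exists y => // i; apply/ler_addgt0Pr => e e0.
have [N hN] := ay e e0.
have := hN _ (leq_maxl N i.*2.+1); set n := maxn _ _ => hn.
have := ha n i (leq_maxr _ _); have := dist_tri S (pseq S (s i.*2)) (a n) y.
lra.
Qed.

(** A branch carries a code of [y] in its even entries and a witness of [P (x, y)] in its odd ones.
    Existence of [y] keeps the set closed, because codes that agree on longer and longer initial
    parts code points converging to the limit point. *)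
Lemma borel_presentation (P : set (X * X)) : borel P ->
  exists K, [/\ kclosed d K,
    forall x s, K x s -> exists2 y, codes s y & P (x, y)
  & forall x y, P (x, y) -> exists2 s, K x s & codes s y].
Proof.
move=> /borel_analytic2 [K0 K0c K0P].
exists (fun x s => exists2 y, codes s y & K0 (x, y) (fun k => s k.*2.+1)).
split; last 2 first.
- by move=> x s [y sy Ky]; exists y => //; apply/K0P; eexists; exact: Ky.
- move=> x y /K0P [t Kt]; have [s sy st] := codes_ex y t.
  exists s => //; exists y => //.
  by rewrite (_ : (fun k => _) = t)//; exact/funext.
move=> x s h.
have /choice [z zP] : forall n, exists p : X * (nat -> nat) * X,
    [/\ d x p.1.1 < eps n, agree n s p.1.2, codes p.1.2 p.2
      & K0 (p.1.1, p.2) (fun k => p.1.2 k.*2.+1)].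
  move=> n; have [z [t [xz st [y ty Ky]]]] := h _ n (eps_gt0 R n).
  by exists (z, t, y).
have [|y sy zy] := @codes_limit s (fun n => (z n).2).
  move=> n; have [_ st ty _] := zP n.
  by apply: codes_upto_agree (agree_sym st) _; exact: codes_codes_upto.
exists y => //; apply: K0c => e n e0.
have [N1 hN1] := zy e e0; have [N2 hN2] := eps_small e0.
pose N := maxn (maxn N1 N2) n.*2.
have [xz st ty Kt] := zP N.
exists ((z N).1.1, (z N).2), (fun k => (z N).1.2 k.*2.+1); split=> //.
  rewrite /dist2/= gt_max; apply/andP; split.
    by apply: lt_trans xz (hN2 _ _); rewrite /N -maxnA maxnCA leq_maxl.
  by rewrite dist_sym hN1// /N -maxnA leq_maxl.
move=> i ni; apply: st; apply: leq_trans (leq_maxr _ _).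
by rewrite ltn_Sdouble.
Qed.

Lemma analytic_proj (P : set (X * X)) : borel P ->
  analytic d [set x | exists y, P (x, y)].
Proof.
move=> /borel_presentation [K [Kc K1 K2]]; exists K => // x; split.
  by move=> [y /K2 [s Ks _]]; exists s.
by move=> [s /K1 [y _ Py]]; exists y.
Qed.

(** Adding a code of [x] to the witness makes each branch determine its point, as the proof of
    separation requires. *)
Lemma analytic_coded (A : set X) : analytic d A ->
  exists K, [/\ kclosed d K, forall x s, K x s -> codes s x
    & forall x, A x <-> exists s, K x s].
Proof.
move=> [K Kc KA].
exists (fun x s => codes s x /\ K x (fun k => s k.*2.+1)); split.
- move=> x s h; split.
    move=> i; apply/ler_addgt0Pr => e e0.
    have [z [t [xz st [tz _]]]] := h e i.*2.+1 e0.
    have := tz i; rewrite -st// => hz.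
    have := dist_tri S (pseq S (s i.*2)) z x; rewrite (dist_sym S z x).
    lra.
  apply: Kc => e n e0; have [z [t [xz st [tz Kt]]]] := h e n.*2 e0.
  exists z, (fun k => t k.*2.+1); split=> // i ni; apply: st.
  by rewrite ltn_Sdouble.
- by move=> x s [].
move=> x; rewrite KA; split=> [[t Kt]|[s [_ Ks]]]; last by eexists; exact: Ks.
have [s sx st] := codes_ex x t; exists s; split=> //.
by rewrite (_ : (fun k => _) = t)//; exact/funext.
Qed.

End Coding.

(** * Baire category *)

Lemma branch_nil (T : Type) (x0 : T) (Q : seq T -> Prop) : Q [::] ->
  (forall t, Q t -> exists k, Q (rcons t k)) ->
  exists s : nat -> T, forall n, Q (mkseq s n).
Proof.
move=> Q0 step.
have /choice [f fP] : forall t, exists k, Q t -> Q (rcons t k).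
  move=> t; have [/step [k Qk]|n] := pselect (Q t); first by exists k.
  by exists x0.
pose u := fix u n := if n is m.+1 then rcons (u m) (f (u m)) else [::].
exists (fun n => f (u n)) => n.
suff [<- //] : u n = mkseq (fun n => f (u n)) n /\ Q (u n).
elim: n => [//|n [IH Qn]]; split; last exact: fP.
by rewrite mkseqS -IH.
Qed.

Definition cylinder (s : seq nat) (t : nat -> nat) : Prop :=
  forall i, (i < size s)%N -> t i = nth 0%N s i.

Lemma cylinder_mkseq t n : cylinder (mkseq t n) t.
Proof. by move=> i; rewrite size_mkseq => ni; rewrite nth_mkseq. Qed.

Lemma cylinder_agree t n t' : cylinder (mkseq t n) t' <-> agree n t t'.
Proof.
split=> h i ni.
  by rewrite h ?size_mkseq// nth_mkseq.
by move: ni; rewrite size_mkseq => ni; rewrite nth_mkseq// h.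
Qed.

Lemma cylinder_prefix s t u : cylinder s t -> agree (size s) t u ->
  cylinder s u.
Proof. by move=> st tu i si; rewrite -tu// st. Qed.

Lemma cylinder_rcons s k t :
  cylinder (rcons s k) t <-> cylinder s t /\ t (size s) = k.
Proof.
split=> [h|[h tk] i].
  split=> [i si|]; last by rewrite h ?size_rcons// nth_rcons ltnn eqxx.
  by rewrite h ?size_rcons ?ltnS 1?ltnW// nth_rcons si.
rewrite size_rcons ltnS leq_eqVlt nth_rcons => /orP [/eqP ->|si].
  by rewrite ltnn eqxx.
by rewrite si h.
Qed.

Lemma branch (Q : seq nat -> Prop) s : Q s ->
  (forall t, Q t -> exists k, Q (rcons t k)) ->
  exists2 t, cylinder s t & forall n, (size s <= n)%N -> Q (mkseq t n).
Proof.
move=> Qs step.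
have [||u uQ] := @branch_nil nat 0%N (fun t => Q (s ++ t)).
- by rewrite cats0.
- by move=> t /step [k Qk]; exists k; rewrite -rcons_cat.
pose t i := if (i < size s)%N then nth 0%N s i else u (i - size s)%N.
exists t => [i si|n sn]; first by rewrite /t si.
rewrite (_ : mkseq t n = s ++ mkseq u (n - size s))//.
apply: (@eq_from_nth _ 0%N); first by rewrite size_cat !size_mkseq subnKC.
move=> i; rewrite size_mkseq => ni; rewrite nth_mkseq// nth_cat /t.
by case: ltnP => // si; rewrite nth_mkseq// ltn_sub2rE.
Qed.

Section Residual.
Variables (R : realType) (X : topologicalType) (S : polish_data R X).
Local Notation d := (pdist S).
Local Notation basic := (basic S).
Implicit Types A B D O : set X.

(** Comeagerness in terms of dense open sets, which suits constructions better than nowhere dense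
    pieces of the complement; [residual_comeager] translates. *)
Definition residual A : Prop := exists2 G : nat -> set X,
  (forall n, open (G n) /\ dense (G n)) & forall x, (forall n, G n x) -> A x.

Lemma residualS A B : A `<=` B -> residual A -> residual B.
Proof. by move=> AB [G oG GA]; exists G => // x /GA /AB. Qed.

Lemma residual_open O : open O -> dense O -> residual O.
Proof. by move=> oO dO; exists (fun=> O) => // x; apply; exact: 0%N. Qed.

Lemma residualT : residual setT.
Proof.
by apply: residual_open => [|O [x Ox] _]; [exact: openT|exists x].
Qed.

Lemma residual_all (I : countType) (P : I -> set X) :
  (forall i, residual (P i)) -> residual [set x | forall i, P i x].
Proof.
move=> /(_ _)/cid2-/all_sig2 [G oG GP].
exists (fun n => if unpickle n is Some (i, k) then G i k else setT).
  move=> n; case: (unpickle n) => [[i k]|]; first exact: oG.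
  by split; [exact: openT|move=> O [x Ox] _; exists x].
move=> x Gx i; apply: GP => k.
by have := Gx (pickle (i, k)); rewrite pickleK.
Qed.

Lemma residualI A B : residual A -> residual B -> residual (A `&` B).
Proof.
move=> rA rB.
have : residual [set x | forall b : bool, (if b then A else B) x].
  by apply: residual_all => -[].
by apply: residualS => x h; split; [exact: (h true)|exact: (h false)].
Qed.

Lemma residual_comeager A : residual A -> comeager A.
Proof.
move=> [G oG GA]; exists (fun n => ~` A `&` ~` G n).
  move=> n; apply/seteqP; split=> x // xi; have [oGn dGn] := oG n.
  have [|y [yi Gy]] := dGn (closure (~` A `&` ~` G n))^° _ (@open_interior _ _).
    by exists x.
  have /= := interior_subset yi => /(_ (G n)) [|z [[_ +] //]].
  exact: open_nbhs_nbhs.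
apply/seteqP; split=> x; last by move=> [n _ []].
move=> nA; apply: contrapT => h; apply: (nA); apply: GA => n.
by apply: contrapT => nG; apply: h; exists n.
Qed.

Lemma residual_gdelta A : residual A ->
  exists G : nat -> set X, [/\ forall n, open (G n),
    [set x | forall n, G n x] `<=` A & residual [set x | forall n, G n x]].
Proof.
move=> [G oG GA]; exists G; split=> [n|x|]; [by case: (oG n)|exact: GA|].
by exists G.
Qed.

Lemma borel_gdelta (G : nat -> set X) : (forall n, open (G n)) ->
  borel [set x | forall n, G n x].
Proof. by move=> oG; apply: borel_all => n; exact: borel_open. Qed.

(** An open set together with its exterior is dense and open: a boundary is negligible. *)
Lemma residual_border O : open O ->
  residual [set x | O x \/ exists i, basic i x /\ forall y, basic i y -> ~ O y].
Proof.
move=> oO; apply: residual_open.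
  rewrite (_ : mkset _ = O `|` \bigcup_(i in [set i | forall y, basic i y -> ~ O y])
    basic i).
    apply: openU => //; apply: bigcup_open => i _; exact: basic_open.
  apply/seteqP; split=> x [|[i]]; try by left.
    by move=> [ix iO]; right; exists i.
  by move=> iO ix; right; exists i.
move=> V [x Vx] oV.
have [[y [Vy Oy]]|no] := pselect (exists y, V y /\ O y).
  by exists y; split=> //; left.
exists x; split=> //; right; have [i [ix iV]] := basic_nbhs S oV Vx.
by exists i; split=> // y /iV Vy Oy; apply: no; exists y.
Qed.

Lemma nested_balls (c : nat -> X) (r : nat -> R) :
  (forall n, 0 <= r n) -> (forall n, r n.+1 <= eps n) ->
  (forall n z, d (c n.+1) z <= r n.+1 -> d (c n) z <= r n) ->
  exists2 y, converges S c y & forall n, d (c n) y <= r n.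
Proof.
move=> r0 re rS.
have cr m n z : d (c (n + m)%N) z <= r (n + m)%N -> d (c n) z <= r n.
  by elim: m => [|m IH]; rewrite ?addn0// addnS => /rS.
have cn m n : (n <= m)%N -> d (c n) (c m) <= r n.
  by move=> nm; apply: (@cr (m - n)%N); rewrite subnKC// dist_xx.
have [y cy] : exists y, converges S c y.
  apply: complete_converges => e e0.
  have [N hN] := @eps_small _ (e / 2) ltac:(lra).
  exists N.+1 => m n Nm Nn.
  have := dist_tri S (c m) (c N.+1) (c n); rewrite (dist_sym S (c m) (c N.+1)).
  by have := cn _ _ Nm; have := cn _ _ Nn; have := re N; have := hN N (leqnn _);
    lra.
exists y => // n; apply/ler_addgt0Pr => e e0; have [N hN] := cy e e0.
have := hN _ (leq_maxl N n); have := cn _ _ (leq_maxr N n).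
have := dist_tri S (c n) (c (maxn N n)) y; lra.
Qed.

Lemma open_cball O x (e : R) : 0 < e -> open O -> O x -> exists r : R,
  [/\ 0 < r, r <= e & forall z, d x z <= r -> O z].
Proof.
move=> e0 oO Ox; have [r r0 rO] := open_dist S oO Ox.
exists (Num.min e (r / 2)); split.
- by rewrite lt_min e0/=; lra.
- by rewrite ge_min lexx.
by move=> z; rewrite le_min => /andP [_ h]; apply: rO; lra.
Qed.

Lemma open_ball x (r : R) : open [set z | d x z < r].
Proof.
apply: (@dist_open _ _ S) => y /= h; exists (r - d x y); first by rewrite subr_gt0.
by move=> z; have := dist_tri S x y z; lra.
Qed.

(** This is the Baire category theorem: closed balls are nested inside the successive dense open
    sets, and completeness provides a common point. *)
Lemma residual_dense D O x : residual D -> open O -> O x ->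
  exists2 y, O y & D y.
Proof.
move=> [G oG GD] oO Ox.
have [r0 [r00 _ r0O]] := open_cball ltr01 oO Ox.
have /choice [f fP] : forall p : X * R * nat, exists q : X * R, 0 < p.1.2 ->
    [/\ 0 < q.2, q.2 <= eps p.2 & forall z, d q.1 z <= q.2 ->
      G p.2 z /\ d p.1.1 z <= p.1.2].
  move=> [[c r] n] /=; have [rp|] := pselect (0 < r); last by exists (c, r).
  have [oGn dGn] := oG n.
  have [|y [cy Gy]] := dGn [set z | d c z < r] _ (open_ball _ _).
    by exists c; rewrite /= dist_xx.
  have [|r' [r'0 r'e r'h]] := open_cball (eps_gt0 R n)
    (openI oGn (open_ball c r)) (x := y); first by split.
  by exists (y, r') => _; split=> // z /r'h [Gz /= /ltW].
pose u := fix u n := if n is m.+1 then f (u m, m) else (x, r0).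
have up n : 0 < (u n).2 by elim: n => [//|n IH /=]; have [] := fP (u n, n) IH.
have [|||y _ yP] := @nested_balls (fun n => (u n).1) (fun n => (u n).2).
- by move=> n; exact: ltW.
- by move=> n /=; have [] := fP (u n, n) (up n).
- by move=> n z /= h; have [_ _ /(_ _ h) []] := fP (u n, n) (up n).
exists y; first exact: r0O (yP 0%N).
by apply: GD => n; have [_ _ /(_ _ (yP n.+1)) []] := fP (u n, n) (up n).
Qed.

(** * Category hulls and the Baire property of analytic sets *)

Section Hull.
Variable A : set X.

Definition meager_in i := residual [set x | ~ (A x /\ basic i x)].

(** The interior of the set of points in no basic neighbourhood of which [A] is meager. *)
Definition hull : set X := [set x | exists i, basic i x /\
  forall y, basic i y -> forall j, basic j y -> ~ meager_in j].

Lemma open_hull : open hull.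
Proof.
apply: (@dist_open _ _ S) => x [i [ix ih]].
have [e e0 eh] := open_dist S (basic_open S i) ix.
by exists e => // y /eh iy; exists i.
Qed.

Lemma hull_closure x e : hull x -> 0 < e -> exists2 z, d x z < e & A z.
Proof.
move=> [i [ix ih]] e0; apply: contrapT => no.
have [|j [jx jb]] := basic_nbhs S (open_ball x e) (x := x).
  by rewrite /= dist_xx.
apply: (ih _ ix _ jx); rewrite /meager_in.
apply: residualS residualT => y _ [Ay /jb xy].
by apply: no; exists y.
Qed.

(** Inside the union [M] of the basic sets where [A] is meager, generic points miss [A]. Outside
    [M], a generic point has a neighbourhood disjoint from [M], so it lies in the hull. *)
Lemma residual_hull : residual [set x | A x -> hull x].
Proof.
pose M : set X := \bigcup_(i in meager_in) basic i.
have r1 : residual [set x | forall i, meager_in i -> ~ (A x /\ basic i x)].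
  apply: residual_all => i; have [m|m] := pselect (meager_in i).
    by apply: residualS m => x h _.
  by apply: residualS residualT => x _ /m.
have oM : open M by apply: bigcup_open => i _; exact: basic_open.
apply: residualS (residualI r1 (residual_border oM)) => x
  [h1 [[i mi ix]|[i [ix iM]]]] Ax.
  by case: (h1 i mi).
exists i; split=> // y /iM nM j jy mj.
by apply: nM; exists j.
Qed.

End Hull.

Section BaireProperty.
Variable K : X -> (nat -> nat) -> Prop.
Hypothesis Kclosed : kclosed d K.

Definition kproj (s : seq nat) : set X :=
  [set x | exists2 t, cylinder s t & K x t].

Lemma kproj_rcons s x : kproj s x -> exists k, kproj (rcons s k) x.
Proof. by move=> [t st Kt]; exists (t (size s)), t => //; apply/cylinder_rcons. Qed.

(** If a basic set meeting the hull of a node avoided the hulls of all its children, the projection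
    of the node, being the union of theirs, would be meager in that basic set. *)
Lemma residual_hull_rcons s :
  residual [set x | hull (kproj s) x -> exists k, hull (kproj (rcons s k)) x].
Proof.
pose J : set X := \bigcup_k hull (kproj (rcons s k)).
have oJ : open J by apply: bigcup_open => k _; exact: open_hull.
apply: residualS (residual_border oJ) => x [[k _ Jk] _|]; first by exists k.
move=> [i [ix iJ]] [j [jx jh]]; exfalso; apply: (jh _ jx i ix).
have : residual [set x | forall k, kproj (rcons s k) x ->
    hull (kproj (rcons s k)) x] by apply: residual_all => k; exact: residual_hull.
apply: residualS => y h [/kproj_rcons [k sk] /iJ]; apply.
by exists k => //; exact: h.
Qed.

(* The Baire property of analytic sets, uniformly in the cylinders of a closed
   set that projects onto the given one. *)
Lemma kproj_baire : exists2 D, residual D &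
  exists2 I : seq nat -> set X, (forall s, open (I s)) &
    forall s x, D x -> (kproj s x <-> I s x).
Proof.
exists ([set x | forall s, kproj s x -> hull (kproj s) x] `&`
  [set x | forall s, hull (kproj s) x ->
    exists k, hull (kproj (rcons s k)) x]).
  by apply: residualI; apply: residual_all => s;
    [exact: residual_hull|exact: residual_hull_rcons].
exists (fun s => hull (kproj s)); first by move=> s; exact: open_hull.
move=> s x [D1 D2]; split; first exact: D1.
(* Along this branch [x] stays in the hulls, so each node is realised by points of [K] arbitrarily
   close to [x]; closedness of [K] then puts the branch over [x] itself. *)
move=> sx; have [t st tQ] := @branch (fun s => hull (kproj s) x) s sx
  (fun t h => D2 t h).
exists t => //; apply: Kclosed => e n e0.
have [z xz [u tu Ku]] := hull_closure (tQ (maxn (size s) n) (leq_maxl _ _)) e0.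
exists z, u; split=> // i ni; move/cylinder_agree: tu; apply.
exact: leq_trans ni (leq_maxr _ _).
Qed.

End BaireProperty.

Lemma borel_baire (I : countType) (A : I -> set X) : (forall i, borel (A i)) ->
  exists2 D, residual D & exists2 U : I -> set X, (forall i, open (U i)) &
    forall i x, D x -> (A i x <-> U i x).
Proof.
move=> bA.
have /(_ _)/cid2-/all_sig2 [D rD UP] : forall i, exists2 D, residual D &
    exists2 U : set X, open U & forall x, D x -> (A i x <-> U x).
  move=> i; have [K Kc KA] := borel_analytic1 S (bA i).
  have [D rD [V oV DV]] := kproj_baire Kc; exists D => //.
  exists (V [::]) => // x Dx; rewrite -(DV _ _ Dx) KA.
  by split=> [[t Kt]|[t _ Kt]]; exists t.
have /all_sig2 [U oU DU] := fun i => cid2 (UP i).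
exists [set x | forall i, D i x]; first exact: residual_all.
by exists U => // i x /(_ i); exact: DU.
Qed.

End Residual.

(** * Borel enumeration of sections on a residual set *)

Section BaireUniformization.
Variables (R : realType) (X : topologicalType) (S : polish_data R X).
Local Notation d := (pdist S).
Local Notation basic := (basic S).
Local Notation codes := (codes S).
Local Notation codes_upto := (codes_upto S).

(** Baire category on the closed set [Q] of branches: countably many points are coded, so some
    neighbourhood of a branch codes a single one. Otherwise a branch could be built that avoids
    coding the points of [Y] one after the other. *)
Lemma branch_baire (Q : (nat -> nat) -> Prop) (Y : set X) s0 :
  (forall s, (forall n, exists2 t, agree n s t & Q t) -> Q s) ->
  (forall s, Q s -> exists2 y, codes s y & Y y) -> countable Y -> Q s0 ->
  exists s n, Q s /\ forall t u y z, Q t -> Q u -> agree n s t ->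
    agree n s u -> codes t y -> codes u z -> y = z.
Proof.
move=> Qc QY /countable_injP [f finj] Qs0; apply: contrapT => no.
have Ycode t y : Q t -> codes t y -> Y y.
  by move=> /QY [z tz Yz] ty; rewrite (codes_inj ty tz).
have ncst s m n : Q s ->
    exists t y, [/\ Q t, agree m s t, codes t y & f y <> n].
  move=> Qs; apply: contrapT => no'; apply: no; exists s, m; split=> //.
  move=> t u y z Qt Qu st su ty uz; apply: finj.
  - by rewrite inE; exact: Ycode Qt ty.
  - by rewrite inE; exact: Ycode Qu uz.
  have -> : f y = n by apply: contrapT => yn; apply: no'; exists t, y.
  by apply/esym; apply: contrapT => zn; apply: no'; exists u, z.
have /choice [g gP] : forall p : ((nat -> nat) * nat) * nat,
    exists q : (nat -> nat) * nat, Q p.1.1 ->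
    [/\ Q q.1, agree p.1.2 p.1.1 q.1, (p.1.2 < q.2)%N &
      forall u y, Q u -> agree q.2 q.1 u -> codes u y -> f y <> p.2].
  move=> [[s m] n] /=; have [Qs|nQ] := pselect (Q s); last by exists (s, m).
  have [t [y [Qt st ty yn]]] := ncst s m n Qs.
  have [[w [Yw wn]]|nw] := pselect (exists w, Y w /\ f w = n); last first.
    exists (t, m.+1) => _; split=> //= u z Qu _ uz zn.
    by apply: nw; exists z; split=> //; exact: Ycode Qu uz.
  have yw : y <> w by move=> yw; apply: yn; rewrite yw.
  have /eps_small [i hi] : 0 < d y w / 2 by have := dist_gt0 S yw; lra.
  (* Entry [i.*2] of [t] confines the coded point to distance at most [2 * eps i] from [y], which
     excludes the point [w] with number [n]. *)
  exists (t, maxn m.+1 i.*2.+1) => _; split=> //=; first exact: leq_maxl.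
  move=> u z Qu tu uz zn.
  have zw : z = w.
    apply: finj; rewrite ?inE ?wn//; exact: Ycode Qu uz.
  have := @codes_upto_near _ _ S i i.*2.+1 t y w (ltnSn _)
    (codes_codes_upto ty).
  have tw : codes_upto i.*2.+1 t w.
    apply: (@codes_upto_agree _ _ _ _ u); last by rewrite -zw; exact: codes_codes_upto.
    by move=> k ki; rewrite tu// (leq_trans ki)// leq_maxr.
  by move=> /(_ tw); have := hi i (leqnn _); lra.
pose v := fix v n := if n is m.+1 then g (v m, m) else (s0, 0%N).
have vQ n : Q (v n).1 by elim: n => [//|n IH /=]; have [] := gP (v n, n) IH.
have vS n : agree (v n).2 (v n).1 (v n.+1).1 by have [] := gP (v n, n) (vQ n).
have vm n : ((v n).2 < (v n.+1).2)%N by have [] := gP (v n, n) (vQ n).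
have vn n : (n <= (v n).2)%N.
  by elim: n => // n IH; exact: leq_ltn_trans IH (vm n).
have vle m n : ((v n).2 <= (v (n + m)%N).2)%N.
  by elim: m => [|m IH]; rewrite ?addn0// addnS; apply: leq_trans IH (ltnW (vm _)).
have vagree m n : agree (v n).2 (v n).1 (v (n + m)%N).1.
  elim: m => [|m IH]; rewrite ?addn0// addnS => i ni.
  by rewrite IH//; apply: vS; exact: leq_trans ni (vle _ _).
pose w k := (v k.+1).1 k.
have vw n : agree (v n).2 (v n).1 w.
  move=> k kn; rewrite /w; have [nk|kn'] := leqP n k.+1.
    by rewrite -(subnKC nk); exact: vagree.
  by rewrite -(subnKC (ltnW kn')); apply/esym/vagree; exact: vn.
have Qw : Q w.
  apply: Qc => n; exists (v n).1 => // i ni; apply/esym/(vw n).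
  exact: leq_trans ni (vn n).
have [y wy Yy] := QY w Qw.
have [_ _ _ /(_ w y Qw (vw (f y).+1) wy)] := gP (v (f y), f y) (vQ (f y)).
by [].
Qed.

Section Uniformize.
Variable F : set (X * X).
Hypothesis Frefl : forall x, F (x, x).
Hypothesis Fcountable : forall x, countable (eqclass F x).
Variable K : X -> (nat -> nat) -> Prop.
Hypothesis Kclosed : kclosed d K.
Hypothesis KF : forall x s, K x s -> exists2 y, codes s y & F (x, y).
Hypothesis FK : forall x y, F (x, y) -> exists2 s, K x s & codes s y.

Let KF' x s y : K x s -> codes s y -> F (x, y).
Proof. by move=> /KF [z sz Fz] sy; rewrite (codes_inj sy sz). Qed.

Definition coverable (i : nat * nat) (s : seq nat) : Prop :=
  exists g : nat -> X -> X, [/\ forall j, borel_fun (g j),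
    forall j x, F (x, g j x)
  & residual [set x | basic i x -> forall t y, cylinder s t -> K x t ->
      codes t y -> exists j, g j x = y]].

(** What is left of [K] after removing all open pieces whose coded points are already enumerated
    generically, as in a Cantor-Bendixson analysis. It will turn out to be empty over a residual
    set. *)
Definition remainder (x : X) (t : nat -> nat) : Prop :=
  K x t /\ forall i n, basic i x -> ~ coverable i (mkseq t n).

Lemma agree_mkseq n t u : agree n t u -> mkseq t n = mkseq u n.
Proof.
move=> tu; apply: (@eq_from_nth _ 0%N); rewrite ?size_mkseq// => i ni.
by rewrite !nth_mkseq// tu.
Qed.

Lemma remainder_closed : kclosed d remainder.
Proof.
move=> x t h; split.
  apply: Kclosed => e n e0; have [z [u [xz tu [Ku _]]]] := h e n e0.
  by exists z, u.
move=> i n ix; have [e e0 ei] := open_dist S (basic_open S i) ix.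
have [z [u [xz tu [_ /(_ i n)]]]] := h e n e0.
by rewrite (agree_mkseq tu); apply; exact: ei.
Qed.

Definition node_codes (t : seq nat) (y : X) : Prop :=
  codes_upto (size t) (nth 0%N t) y.

Lemma node_codes_cylinder t u y : cylinder t u -> codes u y -> node_codes t y.
Proof.
move=> tu uy; apply: (@codes_upto_agree _ _ _ _ u); last exact: codes_codes_upto.
by move=> i /tu.
Qed.

Lemma node_codes_near i n t y z : (i.*2 < n)%N -> codes t y ->
  node_codes (mkseq t n) z -> d y z <= 2 * eps i.
Proof.
move=> ni ty tz; apply: (codes_upto_near ni (codes_codes_upto ty)).
move: tz; rewrite /node_codes size_mkseq; apply: codes_upto_agree => j jn.
by rewrite nth_mkseq.
Qed.

Definition extends (s t : seq nat) := forall v, cylinder t v -> cylinder s v.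

Lemma extends_mkseq s t n : cylinder s t -> (size s <= n)%N ->
  extends s (mkseq t n).
Proof.
move=> st sn v /cylinder_agree tv; apply: cylinder_prefix st _ => i si.
by apply: tv; exact: leq_trans si sn.
Qed.

Section Remainder.
Variables (G : nat -> set X) (I : seq nat -> set X).
Let D := [set x | forall n, G n x].
Hypothesis oG : forall n, open (G n).
Hypothesis oI : forall s, open (I s).
Hypothesis DI : forall s x, D x -> (kproj remainder s x <-> I s x).

(** Over [D] this says that two branches of the remainder through [s] code different points; stating
    it through [I] makes it open. *)
Definition splits (s : seq nat) : set X :=
  \bigcup_(p in [set p : seq nat * seq nat | [/\ extends s p.1, extends s p.2
    & forall y, node_codes p.1 y -> ~ node_codes p.2 y]]) (I p.1 `&` I p.2).

Lemma open_splits s : open (splits s).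
Proof. by apply: bigcup_open => p _; exact: openI. Qed.

Lemma not_splits s x t u y z : D x -> ~ splits s x ->
  remainder x t -> remainder x u -> cylinder s t -> cylinder s u ->
  codes t y -> codes u z -> y = z.
Proof.
move=> Dx ns Qt Qu st su ty uz; apply: contrapT => yz; apply: ns.
(* A point [w] compatible with both nodes would be within [2 * eps i] of [y] and of [z], hence the
   factor 4. *)
have /eps_small [i hi] : 0 < d y z / 4 by have := dist_gt0 S yz; lra.
pose N := maxn (size s) i.*2.+1.
have iN : (i.*2 < N)%N by exact: leq_maxr.
exists (mkseq t N, mkseq u N) => /=.
  split; try by apply: extends_mkseq => //; exact: leq_maxl.
  move=> w /(node_codes_near iN ty) yw /(node_codes_near iN uz) zw.
  have := dist_tri S y w z; rewrite (dist_sym S w z).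
  by have := hi i (leqnn _); lra.
split; apply/(DI _ Dx); [exists t|exists u] => //; exact: cylinder_mkseq.
Qed.

Lemma splits_ex s x : D x -> splits s x -> exists t u y z,
  [/\ remainder x t, remainder x u, cylinder s t & cylinder s u] /\
  [/\ codes t y, codes u z & y <> z].
Proof.
move=> Dx [[t u] /= [st su tu] [/(DI _ Dx) [t' tt' Qt] /(DI _ Dx) [u' uu' Qu]]].
have [y ty _] := KF Qt.1; have [z uz _] := KF Qu.1.
exists t', u', y, z; split; split=> //; [exact: st|exact: su|].
move=> yz; apply: (tu y); first exact: node_codes_cylinder ty.
by rewrite yz; exact: node_codes_cylinder uz.
Qed.

Section ConstantPart.
Variables (j : nat * nat) (s : seq nat).
Hypothesis jI : forall x, basic j x -> I s x.
Hypothesis jO : forall x, basic j x -> ~ splits s x.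

(** Over [basic j] and within [D], the remaining branches through [s] code exactly one point. It
    lies in an open [O] as soon as some node [t] below [s] forces this, and the existence of a
    branch through [t] is the open condition [I t]. Elsewhere [h] is the identity. *)
Lemma constant_part : exists h : X -> X, [/\ borel_fun h,
  forall x, F (x, h x) & forall x t y, D x -> basic j x -> cylinder s t ->
    remainder x t -> codes t y -> h x = y].
Proof.
have /choice [h hP] : forall x, exists y,
    (D x /\ basic j x -> exists t, [/\ cylinder s t, remainder x t & codes t y])
    /\ (~ (D x /\ basic j x) -> y = x).
  move=> x; have [[Dx jx]|nx] := pselect (D x /\ basic j x).
    have [t st Qt] : kproj remainder s x by apply/(DI _ Dx)/jI.
    have [y ty _] := KF Qt.1.
    by exists y; split=> [_|/(_ (conj Dx jx))//]; exists t.
  by exists x; split.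
exists h; split.
- apply: borel_fun_open => O oO.
  rewrite (_ : _ @^-1` _ = [set x | ((D x /\ basic j x) /\ exists t,
      extends s t /\ (forall y, node_codes t y -> O y) /\ I t x) \/
    (~ (D x /\ basic j x) /\ O x)]).
    have bDj : borel [set x | D x /\ basic j x].
      by apply: borel_and; [exact: borel_gdelta|exact: borel_basic].
    apply: borel_or; apply: borel_and => //.
    + apply: borel_ex => t; apply: borel_and; first exact: borel_const.
      apply: borel_and; first exact: borel_const.
      exact: borel_open.
    + exact: borel_not.
    + exact: borel_open.
  have hx x : D x -> basic j x -> exists t,
      [/\ cylinder s t, remainder x t & codes t (h x)].
    by move=> Dx jx; apply: (hP x).1.
  apply/seteqP; split=> x /=.
    move=> Oh; have [[Dx jx]|nx] := pselect (D x /\ basic j x); last first.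
      by right; split=> //; rewrite -{1}((hP x).2 nx).
    left; split=> //; have [t [st Qt th]] := hx x Dx jx.
    have [e e0 eO] := open_dist S oO Oh.
    have /eps_small [i hi] : 0 < e / 2 by lra.
    pose N := maxn (size s) i.*2.+1.
    exists (mkseq t N); split; first by apply: extends_mkseq => //; exact: leq_maxl.
    split; last by apply/(DI _ Dx); exists t => //; exact: cylinder_mkseq.
    move=> y /(node_codes_near (leq_maxr (size s) i.*2.+1) th) hy; apply: eO.
    by have := hi i (leqnn _); lra.
  move=> [[[Dx jx] [t [st [tO /(DI _ Dx) [u tu Qu]]]]]|[nx Ox]]; last first.
    by rewrite (hP x).2.
  have [v [sv Qv vh]] := hx x Dx jx; have [y uy _] := KF Qu.1.
  rewrite (not_splits Dx (jO jx) Qv Qu sv (st _ tu) vh uy).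
  by apply: tO; exact: node_codes_cylinder uy.
- move=> x; have [[Dx jx]|nx] := pselect (D x /\ basic j x).
    have [t [_ [Kt _] th]] := (hP x).1 (conj Dx jx); exact: KF' Kt th.
  by rewrite (hP x).2.
- move=> x t y Dx jx st Qt ty; have [u [su Qu uh]] := (hP x).1 (conj Dx jx).
  exact: not_splits Dx (jO jx) Qu Qt su st uh ty.
Qed.

End ConstantPart.
End Remainder.

(** Generically every node that meets the remainder splits, since a node that does not split over
    some basic set is coverable by [constant_part]. But the classes are countable, so by
    [branch_baire] a nonempty remainder would have a node that does not split. Hence the remainder
    is generically empty. *)
Lemma uniformize_presented : exists f : nat -> X -> X,
  [/\ forall n, borel_fun (f n), forall n x, F (x, f n x)
    & residual [set x | forall y, F (x, y) -> exists n, f n x = y]].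
Proof.
have /choice [g gP] : forall p : (nat * nat) * seq nat,
    exists g : nat -> X -> X, [/\ forall j, borel_fun (g j),
      forall j x, F (x, g j x)
    & coverable p.1 p.2 -> residual [set x | basic p.1 x ->
        forall t y, cylinder p.2 t -> K x t -> codes t y ->
        exists j, g j x = y]].
  move=> [i s] /=; have [[g [g1 g2 g3]]|nc] := pselect (coverable i s).
    by exists g.
  by exists (fun _ x => x); split=> [j|//|/nc//]; exact: borel_id.
(* There are only countably many pairs, so one sequence collects the covering functions of all of
   them. *)
pose f n := if unpickle n is Some (p, j) then g p j else id.
have bf n : borel_fun (f n).
  by rewrite /f; case: (unpickle n) => [[p j]|//]; have [] := gP p.
have Ff n x : F (x, f n x).
  by rewrite /f; case: (unpickle n) => [[p j]|//]; have [] := gP p.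
exists f; split=> //.
pose D1 : set X := [set x | forall p : (nat * nat) * seq nat,
  coverable p.1 p.2 -> basic p.1 x -> forall t y, cylinder p.2 t -> K x t ->
  codes t y -> exists n, f n x = y].
have rD1 : residual D1.
  apply: residual_all => p; have [cp|nc] := pselect (coverable p.1 p.2).
    have [_ _ /(_ cp)] := gP p; apply: residualS => x h _ /h {}h t y pt Kt ty.
    have [j <-] := h t y pt Kt ty; exists (pickle (p, j)).
    by rewrite /f pickleK.
  by apply: residualS (residualT _) => x _ /nc.
have [D' rD' [I oI D'I]] := kproj_baire remainder_closed.
have [G [oG GD' rD]] := residual_gdelta rD'.
set D := [set x | _] in GD' rD.
have DI s x : D x -> (kproj remainder s x <-> I s x) by move=> /GD'; exact: D'I.
have covered x t y : D1 x -> K x t -> codes t y -> ~ remainder x t ->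
    exists n, f n x = y.
  move=> D1x Kt ty nQ.
  have [[i [n [ix cn]]]|no] :=
    pselect (exists i n, basic i x /\ coverable i (mkseq t n)).
    exact: (D1x (i, mkseq t n) cn ix t y (@cylinder_mkseq _ _) Kt ty).
  by exfalso; apply: nQ; split=> // i n ix cn; apply: no; exists i, n.
have rO s : residual [set x | I s x -> splits I s x].
  apply: residualS (residual_border S (open_splits oI s)) =>
    x [Os _|[i [ix iO]] Isx]; [exact: Os|exfalso].
  have [j [jx jh]] := basic_nbhs S (openI (basic_open S i) (oI s)) (conj ix Isx).
  have [h [bh Fh hP]] := constant_part oG oI DI (fun y jy => (jh y jy).2)
    (fun y jy => iO y (jh y jy).1).
  (* The function [h] reaches the points coded in the remainder and the sequence [f] all others. So
     [(j, s)] is coverable, although a branch of the remainder passes through [s] over [basic j]. *)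
  have cj : coverable j s.
    exists (fun n => if n is m.+1 then f m else h); split=> [[|n]//|[|n]//|].
    apply: residualS (residualI rD rD1) => y [Dy D1y] jy t z st Kt tz.
    have [Qt|nQ] := pselect (remainder y t).
      by exists 0%N; exact: hP Qt tz.
    by have [n <-] := covered y t z D1y Kt tz nQ; exists n.+1.
  have [y jy Dy] := residual_dense S rD (basic_open S j) jx.
  have [t st [_ /(_ j (size s) jy)]] : kproj remainder s y.
    by apply/(DI _ _ Dy); exact: (jh y jy).2.
  rewrite (_ : mkseq t (size s) = s)//.
  apply: (@eq_from_nth _ 0%N); rewrite size_mkseq// => k sk.
  by rewrite nth_mkseq// st.
apply: residualS (residualI (residualI rD1 rD) (residual_all rO)).
move=> x [[D1x Dx] xO] y /FK [t Kt ty].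
apply: contrapT => no; have [Qt|nQ] := pselect (remainder x t); last first.
  by apply: no; exact: covered D1x Kt ty nQ.
have [||||u [n [Qu uc]]] := @branch_baire (remainder x) (eqclass F x) t.
- move=> s h; apply: remainder_closed => e n e0; have [v sv Qv] := h n.
  by exists x, v; rewrite dist_xx.
- by move=> s [/KF [z sz Fz] _]; exists z.
- exact: Fcountable.
- exact: Qt.
have /xO : I (mkseq u n) x.
  by apply/(DI _ _ Dx); exists u => //; exact: cylinder_mkseq.
move=> /(splits_ex DI Dx) [v [w [y' [z' [[Qv Qw vu wu] [vy wz]]]]]]; apply.
by apply: (uc v w) => //; apply/cylinder_agree.
Qed.

End Uniformize.

Lemma baire_uniformization (F : set (X * X)) : borel F ->
  (forall x, F (x, x)) -> (forall x, countable (eqclass F x)) ->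
  exists f : nat -> X -> X,
  [/\ forall n, borel_fun (f n), forall n x, F (x, f n x)
    & residual [set x | forall y, F (x, y) -> exists n, f n x = y]].
Proof.
move=> bF rF cF; have [K [Kc KF FK]] := borel_presentation S bF.
exact: (@uniformize_presented _ rF cF K Kc KF FK).
Qed.

End BaireUniformization.

(** * Separation and Borel inverses *)

Lemma borel_fst (X Y : topologicalType) : borel_fun (@fst X Y).
Proof.
apply: borel_fun_open => O oO; apply: borel_open; apply: open_comp => // p _.
exact: cvg_fst.
Qed.

Lemma borel_snd (X Y : topologicalType) : borel_fun (@snd X Y).
Proof.
apply: borel_fun_open => O oO; apply: borel_open; apply: open_comp => // p _.
exact: cvg_snd.
Qed.

Section BorelInverse.
Variables (R : realType) (X : topologicalType) (S : polish_data R X).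
Local Notation d := (pdist S).
Local Notation basic := (basic S).
Local Notation codes := (codes S).
Local Notation codes_upto := (codes_upto S).

Lemma kproj_codes_upto K s n x : (forall x s, K x s -> codes s x) ->
  kproj K (mkseq s n) x -> codes_upto n s x.
Proof.
move=> Kx [t /cylinder_agree st /Kx tx].
by apply: codes_upto_agree (agree_sym st) _; exact: codes_codes_upto.
Qed.

(** Points realising longer and longer initial parts of [s] converge, because each branch codes its
    own point. *)
Lemma kproj_limit K s : kclosed d K -> (forall x s, K x s -> codes s x) ->
  (forall n, exists x, kproj K (mkseq s n) x) -> exists x, K x s.
Proof.
move=> Kc Kx /choice [a aP].
have [|x sx ax] := @codes_limit _ _ S s a.
  by move=> n; exact: kproj_codes_upto (aP n).
exists x; apply: Kc => e n e0; have [N hN] := ax e e0.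
have [t /cylinder_agree st Kt] := aP (maxn N n).
exists (a (maxn N n)), t; split=> //.
  by rewrite dist_sym; apply: hN; exact: leq_maxl.
by move=> i ni; apply: st; exact: leq_trans ni (leq_maxr _ _).
Qed.

Theorem lusin_separation (A B : set X) : analytic d A -> analytic d B ->
  (forall x, A x -> ~ B x) ->
  exists C, [/\ borel C, A `<=` C & forall x, B x -> ~ C x].
Proof.
move=> /analytic_coded [KA [KAc KAx KAA]] /analytic_coded [KB [KBc KBx KBB]] AB.
apply: contrapT => nosep.
(* If all pairs of children are separated by sets [C (i, j)], then the union over [i] of the
   intersections over [j] separates the parents. So inseparability passes down along a branch of
   pairs. *)
pose sep (w : seq (nat * nat)) := exists C, [/\ borel C,
  kproj KA (unzip1 w) `<=` C & forall x, kproj KB (unzip2 w) x -> ~ C x].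
have [||s sP] := @branch_nil _ (0%N, 0%N) (fun w => ~ sep w).
- move=> [C [bC AC BC]]; apply: nosep; exists C; split=> // x.
    by move=> /KAA [s Ks]; apply: AC; exists s.
  by move=> /KBB [s Ks]; apply: BC; exists s.
- move=> w nw; apply: contrapT => h; apply: nw.
  have /choice [C CP] : forall p, exists C, [/\ borel C,
      kproj KA (rcons (unzip1 w) p.1) `<=` C
      & forall x, kproj KB (rcons (unzip2 w) p.2) x -> ~ C x].
    move=> p; apply: contrapT => nC; apply: h; exists p => -[C].
    by rewrite /unzip1 /unzip2 !map_rcons => CP; apply: nC; exists C.
  exists [set x | exists i, forall j, C (i, j) x]; split.
  + apply: borel_ex => i; apply: borel_all => j; by have [] := CP (i, j).
  + move=> x /kproj_rcons [i xi]; exists i => j; have [_ AC _] := CP (i, j).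
    exact: AC.
  + move=> x /kproj_rcons [j xj] [i /(_ j)]; have [_ _ BC] := CP (i, j).
    exact: BC.
have us1 n : unzip1 (mkseq s n) = mkseq (fun i => (s i).1) n.
  by rewrite /unzip1 -map_comp.
have us2 n : unzip2 (mkseq s n) = mkseq (fun i => (s i).2) n.
  by rewrite /unzip2 -map_comp.
(* Both projections of an inseparable pair are nonempty, or else the empty set or the whole space
   would separate them. *)
have [|a Ka] := @kproj_limit KA (fun i => (s i).1) KAc KAx.
  move=> n; apply: contrapT => no; apply: (sP n); exists set0; split.
  - exact: borel0.
  - by move=> x; rewrite us1 => xA; case: no; exists x.
  - by move=> x _; case.
have [|b Kb] := @kproj_limit KB (fun i => (s i).2) KBc KBx.
  move=> n; apply: contrapT => no; apply: (sP n); exists setT; split=> [|//|].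
  - by apply: borel_open; exact: openT.
  - by move=> x; rewrite us2 => xB; case: no; exists x.
have ab : a <> b.
  move=> ab; apply: (AB a); first by apply/KAA; eexists; exact: Ka.
  by rewrite ab; apply/KBB; eexists; exact: Kb.
(* A closed ball around the [i]-th centre of the first code separates the nodes: a common point
   would join [a] to [b] in four steps of length at most [eps i]. *)
have /eps_small [i hi] : 0 < d a b / 4 by have := dist_gt0 S ab; lra.
have := hi i (leqnn _) => {}hi.
apply: (sP i.*2.+1); exists [set y | d (pseq S (s i.*2).1) y <= eps i]; split.
- exact: borel_cball.
- by move=> x; rewrite us1 => /(kproj_codes_upto KAx) /(_ i (ltnSn _)).
move=> x; rewrite us2 => /(kproj_codes_upto KBx) /(_ i (ltnSn _)) /= h1 h2.
have /(_ i) h3 := KAx _ _ Ka; have /(_ i) h4 := KBx _ _ Kb.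
have := dist_tri S a (pseq S (s i.*2).1) b.
have := dist_tri S (pseq S (s i.*2).1) x b.
have := dist_tri S x (pseq S (s i.*2).2) b.
rewrite (dist_sym S a (pseq _ _)) (dist_sym S x (pseq _ _)) /= in h3 h4 *.
lra.
Qed.

Lemma analytic_image (A : set X) (f : X -> X) : borel A -> borel_fun f ->
  analytic d [set z | exists x, A x /\ f x = z].
Proof.
move=> bA bf; apply: (@analytic_proj _ _ S [set p | A p.2 /\ f p.2 = p.1]).
apply: borel_and; first by apply: borel_comp => //; exact: borel_snd.
apply: (borel_eq S); last exact: borel_fst.
by apply: borel_fun_comp => //; exact: borel_snd.
Qed.

(* The sets [L i] separating [f (A /\ basic i)] from [f (A \ basic i)] tell,
   for [z = f x], in which basic open sets the preimage [x] lies. *)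
Lemma borel_inverse (A : set X) (f : X -> X) : borel A -> borel_fun f ->
  (forall x y, A x -> A y -> f x = f y -> x = y) ->
  exists2 g, borel_fun g & forall x, A x -> g (f x) = x.
Proof.
move=> bA bf finj.
have /choice [L LP] : forall i, exists C, [/\ borel C,
    [set z | exists x, (A x /\ basic i x) /\ f x = z] `<=` C
    & forall z, (exists x, (A x /\ ~ basic i x) /\ f x = z) -> ~ C z].
  move=> i; apply: lusin_separation.
  - apply: (@analytic_image [set x | A x /\ basic i x]) => //.
    by apply: borel_and => //; exact: borel_basic.
  - apply: (@analytic_image [set x | A x /\ ~ basic i x]) => //.
    by apply: borel_and => //; apply: borel_not; exact: borel_basic.
  move=> z [x [[Ax ix] fx]] [y [[Ay iy] fy]]; apply: iy.
  by rewrite -(finj x y)// fx fy.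
have bL i : borel (L i) by have [] := LP i.
have LA i x : A x -> (L i (f x) <-> basic i x).
  move=> Ax; have [_ L1 L2] := LP i; split=> [Lx|ix]; last by apply: L1; exists x.
  by apply: contrapT => nix; apply: (L2 (f x)) Lx; exists x.
(* The coherence condition under which the labels of [z] have Cauchy centres; it holds on the image
   of [A], and off it [g] is the identity. *)
pose Q z := (forall n, exists k, L (k, n) z) /\
  (forall i j, L i z -> L j z -> exists w, basic i w /\ basic j w).
have bQ : borel [set z | Q z].
  apply: borel_and; first by apply: borel_all => n; exact: borel_ex.
  apply: borel_all => i; apply: borel_all => j.
  by do 2![apply: borel_imply => //]; exact: borel_const.
have /choice [g gP] : forall z, exists x,
    (Q z -> forall i, L i z -> d (pseq S i.1) x <= eps i.2) /\
    (~ Q z -> x = z).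
  move=> z; have [Qz|nQ] := pselect (Q z); last by exists z; split.
  have [/choice [k kP] Q2] := Qz.
  have near i n : L i z -> d (pseq S i.1) (pseq S (k n)) <= eps i.2 + eps n.
    move=> /Q2 /(_ (kP n)) [w []]; rewrite /basic/= => h1 h2.
    have := dist_tri S (pseq S i.1) w (pseq S (k n)).
    by rewrite (dist_sym S w); lra.
  have [x kx] : exists x, converges S (fun n => pseq S (k n)) x.
    apply: complete_converges => e e0.
    have [N hN] := @eps_small _ (e / 2) ltac:(lra).
    exists N => m n Nm Nn; have := near _ n (kP m) => /=.
    by have := hN _ Nm; have := hN _ Nn; lra.
  exists x; split=> [_ i Li|/(_ Qz)//]; apply/ler_addgt0Pr => e e0.
  have [N1 hN1] := kx (e / 2) ltac:(lra).
  have [N2 hN2] := @eps_small _ (e / 2) ltac:(lra).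
  have := near i (maxn N1 N2) Li; have := hN1 _ (leq_maxl N1 N2).
  have := hN2 _ (leq_maxr N1 N2).
  have := dist_tri S (pseq S i.1) (pseq S (k (maxn N1 N2))) x.
  lra.
exists g.
  apply: borel_fun_open => O oO.
  rewrite (_ : _ @^-1` _ = [set z | (Q z /\ exists i, L i z /\
      (forall y, d (pseq S i.1) y <= eps i.2 -> O y)) \/ (~ Q z /\ O z)]).
    apply: borel_or; apply: borel_and => //.
    + by apply: borel_ex => i; apply: borel_and => //; exact: borel_const.
    + exact: borel_not.
    + exact: borel_open.
  apply/seteqP; split=> z /=; last first.
    move=> [[Qz [i [Li iO]]]|[nQ Oz]]; last by rewrite (gP z).2.
    by apply: iO; exact: (gP z).1.
  move=> Og; have [Qz|nQ] := pselect (Q z); last first.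
    by right; split=> //; rewrite -{1}((gP z).2 nQ).
  left; split=> //; have [e e0 eO] := open_dist S oO Og.
  have [n hn] := @eps_small _ (e / 2) ltac:(lra).
  have [k Lk] := Qz.1 n; exists (k, n); split=> // y /= ky; apply: eO.
  have := (gP z).1 Qz _ Lk; have := dist_tri S (g z) (pseq S k) y.
  by rewrite (dist_sym S (g z) (pseq _ _))/=; have := hn n (leqnn _); lra.
move=> x Ax.
have Qx : Q (f x).
  split=> [n|i j /LA ix /LA jx]; last by exists x; split; [exact: ix|exact: jx].
  by have [k xk] := basic_small S x n; exists k; apply/LA.
apply: contrapT => /(dist_gt0 S) gx.
have [n hn] := @eps_small _ (d (g (f x)) x / 2) ltac:(lra).
have [k xk] := basic_small S x n.
have /((gP (f x)).1 Qx) /= : L (k, n) (f x) by apply/LA.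
move: xk; rewrite /basic/=.
have := dist_tri S (g (f x)) (pseq S k) x.
rewrite (dist_sym S (g (f x)) (pseq _ _)); have := hn n (leqnn _); lra.
Qed.

(** [Z] is relatively closed in a G_delta set, so Baire category applies to it. Without isolated
    points, shrinking balls centred in [Z] could enter each [G n] and avoid the point numbered [n],
    and their limit would be an unnumbered point of [Z]. *)
Lemma countable_gdelta_isolated (G : nat -> set X) (Z : set X) x0 :
  (forall n, open (G n)) -> (forall n, Z `<=` G n) -> countable Z ->
  (forall c y, (forall n, Z (c n)) -> converges S c y -> (forall n, G n y) ->
    Z y) ->
  Z x0 -> exists y i, [/\ Z y, basic i y & forall z, Z z -> basic i z -> z = y].
Proof.
move=> oG ZG /countable_injP [f finj] Zc Zx0; apply: contrapT => no.
have /choice [g gP] : forall p : X * R * nat, exists q : X * R,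
    Z p.1.1 -> 0 < p.1.2 -> [/\ Z q.1, 0 < q.2, q.2 <= eps p.2
      & forall z, d q.1 z <= q.2 ->
        [/\ G p.2 z, d p.1.1 z <= p.1.2 & Z z -> f z <> p.2]].
  move=> [[c r] n] /=; have [[Zc' r0]|nn] := pselect (Z c /\ 0 < r); last first.
    by exists (c, r) => Zc' r0; case: nn.
  have [y [Zy cy yn]] : exists y, [/\ Z y, d c y < r & f y <> n].
    have [cn|] := pselect (f c = n); last by exists c; rewrite dist_xx.
    have [|i [ic ir]] := basic_nbhs S (open_ball S c r) (x := c).
      by rewrite /= dist_xx.
    apply: contrapT => no'; apply: no; exists c, i; split=> // z Zz iz.
    apply: finj; rewrite ?inE//; rewrite cn; apply: contrapT => zn; apply: no'.
    by exists z; split=> //; exact: ir.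
  have [U [oU Uy UZ]] : exists U, [/\ open U, U y & forall z, Z z -> U z -> f z <> n].
    have [[w [Zw wn]]|nw] := pselect (exists w, Z w /\ f w = n); last first.
      exists setT; split=> //; first exact: openT.
      by move=> z Zz _ zn; apply: nw; exists z.
    have wy : w <> y by move=> wy; apply: yn; rewrite -wy.
    exists [set z | d y z < d y w]; split; first exact: open_ball.
      by rewrite /= dist_xx; apply: dist_gt0 => yw; apply: wy.
    move=> z Zz /= zw zn.
    suff zw' : z = w by move: zw; rewrite zw' ltxx.
    by apply: finj; rewrite ?inE// zn wn.
  have [|r' [r'0 r'e r'h]] := open_cball S (eps_gt0 R n)
    (openI (openI (oG n) (open_ball S c r)) oU) (x := y).
    by split=> //; split=> //; exact: ZG.
  exists (y, r') => _ _; split=> // z /r'h [[Gz /= /ltW cz] Uz].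
  by split=> // Zz; exact: UZ.
pose u := fix u n := if n is m.+1 then g (u m, m) else (x0, 1).
have up n : Z (u n).1 /\ 0 < (u n).2.
  elim: n => [|n [IH1 IH2] /=]; first by split=> //=.
  by have [] := gP (u n, n) IH1 IH2.
have uS n := gP (u n, n) (up n).1 (up n).2.
have [|||y cy yP] := @nested_balls _ _ S (fun n => (u n).1) (fun n => (u n).2).
- by move=> n; apply: ltW; exact: (up n).2.
- by move=> n /=; have [] := uS n.
- by move=> n z h; have [_ _ _ /(_ _ h) []] := uS n.
have yn n : [/\ G n y, d (u n).1 y <= (u n).2 & Z y -> f y <> n].
  by have [_ _ _ /(_ _ (yP n.+1))] := uS n.
have Zy : Z y.
  by apply: (Zc _ _ (fun n => (up n).1) cy) => n; have [] := yn n.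
by have [_ _ /(_ Zy)] := yn (f y).
Qed.

End BorelInverse.

(** * Saturation *)

Section InvariantEnumeration.
Variables (R : realType) (X : topologicalType) (S : polish_data R X).
Local Notation d := (pdist S).
Local Notation basic := (basic S).
Variable F : set (X * X).
Hypothesis Fequiv : equivalence F.
Hypothesis Fcountable : forall x, countable (eqclass F x).

Let Fsym x y : F (x, y) -> F (y, x).
Proof. by case: Fequiv => _ h _; exact: h. Qed.

Let Ftrans x y z : F (x, y) -> F (y, z) -> F (x, z).
Proof. by case: Fequiv => _ _; exact. Qed.

Section Pieces.
Variables (f : nat -> X -> X) (G : nat -> set X).
Let D := [set x | forall n, G n x].
Hypothesis bf : forall n, borel_fun (f n).
Hypothesis Ff : forall n x, F (x, f n x).
Hypothesis oG : forall n, open (G n).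
Hypothesis Dcover : forall x y, D x -> F (x, y) -> exists n, f n x = y.
Hypothesis fcont : forall n i x, D x -> basic i (f n x) ->
  exists2 j, basic j x & forall y, D y -> basic j y -> basic i (f n y).

(* The points of [D] isolated by the basic set [k] in their fibre of [f n]. *)
Definition piece (p : nat * (nat * nat)) : set X :=
  [set x | D x /\ (basic p.2 x /\ forall m, (D (f m x) /\ (basic p.2 (f m x) /\
    f p.1 (f m x) = f p.1 x)) -> f m x = x)].

Let bD : borel D. Proof. exact: borel_gdelta. Qed.

Lemma borel_piece p : borel (piece p).
Proof.
apply: borel_and => //; apply: borel_and; first exact: borel_basic.
apply: borel_all => m; apply: borel_imply; last first.
  by apply: (borel_eq S) => //; exact: borel_id.
apply: borel_and; first exact: borel_comp.
apply: borel_and; first by apply: borel_comp => //; exact: borel_basic.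
by apply: (borel_eq S) => //; exact: borel_fun_comp.
Qed.

Lemma piece_inj p x y : piece p x -> piece p y -> f p.1 x = f p.1 y -> x = y.
Proof.
move=> [Dx [px hx]] [Dy [py hy]] xy.
have [m mxy] : exists m, f m x = y.
  by apply: Dcover => //; apply: Ftrans (Ff p.1 x) _; rewrite xy; exact: Fsym.
by rewrite -mxy; apply/esym/hx; rewrite mxy.
Qed.

(** The fibre of [f n] in [D] lies in one class, so it is countable, and relative continuity makes
    it closed in [D]; hence it has an isolated point. *)
Lemma piece_cover n x : D x -> exists k y, piece (n, k) y /\ f n y = f n x.
Proof.
move=> Dx; pose Z := [set y | D y /\ f n y = f n x].
have [||||y [i [[Dy yx] iy yZ]]] := @countable_gdelta_isolated _ _ S G Z x oG.
- by move=> m y [/(_ m)].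
- apply: sub_countable (Fcountable x); apply: subset_card_le => y [_ yx].
  by apply: Ftrans (Ff n x) _; rewrite -yx; exact: Fsym.
- move=> c y cZ cy Dy; split=> //; apply: contrapT => /(dist_gt0 S) ne.
  have [e he] := @eps_small _ (d (f n y) (f n x) / 2) ltac:(lra).
  have [k ke] := basic_small S (f n y) e.
  have [j jy jh] := fcont Dy ke.
  have [r r0 rj] := open_dist S (basic_open S j) jy.
  have [N hN] := cy r r0; have [DcN cN] := cZ N.
  have : basic (k, e) (f n (c N)).
    by apply: jh => //; apply: rj; rewrite dist_sym; exact: hN.
  move: ke; rewrite cN /basic/=.
  have := dist_tri S (f n y) (pseq S k) (f n x).
  rewrite (dist_sym S (f n y) (pseq _ _)); have := he e (leqnn _); lra.
- by split.
exists i, y; split=> //; split=> //; split=> //= m [Dm [im fm]].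
by apply: yZ => //; split=> //; rewrite fm.
Qed.

Lemma saturation_enumeration : residual D ->
  exists C : set X, exists e : nat -> X -> X,
  [/\ borel C, residual C & forall x y, F (x, y) -> C x -> C y] /\
  [/\ forall m, borel_fun (e m), forall m x, F (x, e m x)
    & forall x y, C x -> F (x, y) -> exists m, e m x = y].
Proof.
move=> rD.
have /(_ _)/cid2-/all_sig2 [g bg gP] : forall p, exists2 g, borel_fun g &
    forall x, piece p x -> g (f p.1 x) = x.
  move=> p; apply: (borel_inverse S) => //; first exact: borel_piece.
  by move=> x y; exact: piece_inj.
(* The image of [piece p], expressed through the Borel inverse and therefore Borel. *)
pose B p z := piece p (g p z) /\ f p.1 (g p z) = z.
have bB p : borel (B p).
  apply: borel_and; first by apply: borel_comp => //; exact: borel_piece.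
  by apply: (borel_eq S); [exact: borel_fun_comp|exact: borel_id].
have BD n x : D x -> exists p, B p (f n x).
  move=> /(piece_cover n) [k [y [py fy]]]; exists (n, k).
  by rewrite /B /= -fy (gP (n, k)).
(* By [piece_cover] this is the [F]-saturation of [D]. *)
pose C := [set z | exists p, B p z].
have bC : borel C by exact: borel_ex.
pose P (o : option (nat * (nat * nat))) : set X :=
  if o is Some p then B p else [set z | ~ C z].
have [||N NP bN] := @borel_select _ _ P.
- by case=> [p|]; [exact: bB|exact: borel_not].
- move=> z; have [[p Bp]|nC] := pselect (C z); last by exists None.
  by exists (Some p).
pose h (o : option (nat * (nat * nat))) := if o is Some p then g p else id.
(* This map sends each point of [C] to an [F]-equivalent point of [D], from which the sequence [f]
   enumerates the class. *)
pose r z := h (N z) z.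
have br : borel_fun r.
  by apply: borel_fun_select => // -[p|]; [exact: bg|exact: borel_id].
have Fr z : F (r z, z) /\ (C z -> D (r z)).
  rewrite /r; have := NP z; case: (N z) => [p|] /=.
    move=> [[Dg _] fg]; split=> //; rewrite -{2}fg; exact: Ff.
  by move=> nC; split=> //; case: Fequiv.
exists C, (fun m z => f m (r z)); split; split=> //.
- apply: residualS rD => x Dx; have [|n <-] := Dcover (y := x) Dx.
    by case: Fequiv.
  exact: BD.
- move=> x y Fxy Cx; have [Frx /(_ Cx) Dr] := Fr x.
  have [n <-] := Dcover Dr (Ftrans Frx Fxy); exact: BD.
- by move=> m; exact: borel_fun_comp.
- by move=> m x; apply: Ftrans (Ff _ _); apply: Fsym; exact: (Fr x).1.
move=> x y Cx Fxy; have [Frx /(_ Cx) Dr] := Fr x.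
exact: Dcover Dr (Ftrans Frx Fxy).
Qed.

End Pieces.

(** The Baire property of the preimages of basic sets makes every [f n] continuous on a residual
    set, which is then shrunk to a G_delta set. *)
Lemma invariant_enumeration : borel F ->
  exists C : set X, exists e : nat -> X -> X,
  [/\ borel C, residual C & forall x y, F (x, y) -> C x -> C y] /\
  [/\ forall m, borel_fun (e m), forall m x, F (x, e m x)
    & forall x y, C x -> F (x, y) -> exists m, e m x = y].
Proof.
move=> bF.
have [f [bf Ff rD0]] := baire_uniformization S bF
  (let: And3 h _ _ := Fequiv in h) Fcountable.
have [D1 rD1 [U oU D1U]] := @borel_baire _ _ S _
  (fun p : nat * (nat * nat) => [set x | basic p.2 (f p.1 x)])
  (fun p => borel_comp (bf p.1) (borel_basic S p.2)).
have [G [oG GD rD]] := residual_gdelta (residualI rD0 rD1).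
apply: (saturation_enumeration bf Ff oG _ _ rD).
  by move=> x y /GD [h _]; exact: h.
move=> n i x Dx ix; have [_ D1x] := GD _ Dx.
have [j [jx jU]] := basic_nbhs S (oU (n, i)) ((D1U (n, i) x D1x).1 ix).
exists j => // y /GD [_ D1y] /jU.
exact: (D1U (n, i) y D1y).2.
Qed.

End InvariantEnumeration.

(** * Markers and generic compression *)

Lemma unbounded_infinite (X : choiceType) (Z : set X) (rk : X -> nat -> Prop) :
  (forall x m n, rk x m -> rk x n -> m = n) ->
  (forall N, exists n x, [/\ (N <= n)%N, Z x & rk x n]) -> infinite_set Z.
Proof.
move=> rkf unb /finite_seqP [s Zs].
have [N hN] : exists N, forall x n, x \in s -> rk x n -> (n < N)%N.
  elim: s {Zs} => [|a s [N IH]]; first by exists 0%N.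
  have [[k ak]|no] := pselect (exists k, rk a k).
    exists (maxn N k.+1) => x n; rewrite inE => /orP [/eqP -> an|xs xn].
      by rewrite (rkf _ _ _ an ak) leq_maxr.
    exact: leq_trans (IH _ _ xs xn) (leq_maxl _ _).
  exists N => x n; rewrite inE => /orP [/eqP -> an|]; last exact: IH.
  by case: no; exists n.
have [n [x [Nn Zx xn]]] := unb N.
have xs : x \in s by move: Zx; rewrite Zs.
by have := hN x n xs xn; rewrite ltnNge Nn.
Qed.

Lemma least_nat (P : nat -> Prop) n : P n ->
  exists2 m, P m & forall i, (i < m)%N -> ~ P i.
Proof.
elim/ltn_ind: n => n IH Pn.
have [[i [im Pi]]|no] := pselect (exists i, (i < n)%N /\ P i).
  exact: IH Pi.
by exists n => // i im Pi; apply: no; exists i.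
Qed.

Section GenericCompression.
Variables (R : realType) (X : topologicalType) (S : polish_data R X).
Local Notation d := (pdist S).
Local Notation basic := (basic S).
Variables (E F : set (X * X)) (C : set X) (e : nat -> X -> X).
Hypothesis bE : borel E.
Hypothesis Eequiv : equivalence E.
Hypothesis Ea : aperiodic E.
Hypothesis Fequiv : equivalence F.
Hypothesis EF : E `<=` F.
Hypothesis bC : borel C.
Hypothesis rC : residual C.
Hypothesis CF : forall x y, F (x, y) -> C x -> C y.
Hypothesis be : forall m, borel_fun (e m).
Hypothesis Fe : forall m x, F (x, e m x).
Hypothesis Ce : forall x y, C x -> F (x, y) -> exists m, e m x = y.

Let Erefl x : E (x, x). Proof. by case: Eequiv. Qed.
Let Esym x y : E (x, y) -> E (y, x).
Proof. by case: Eequiv => _ h _; exact: h. Qed.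
Let Etrans x y z : E (x, y) -> E (y, z) -> E (x, z).
Proof. by case: Eequiv => _ _; exact. Qed.
Let Frefl x : F (x, x). Proof. by case: Fequiv. Qed.
Let Ftrans x y z : F (x, y) -> F (y, z) -> F (x, z).
Proof. by case: Fequiv => _ _; exact. Qed.
Let CE x y : E (x, y) -> C x -> C y.
Proof. by move=> /EF; exact: CF. Qed.
Let be2 m l : borel_fun (fun x => e m (e l x)).
Proof. exact: borel_fun_comp. Qed.

(** Keeping only the first index of each point turns the enumeration into an injective one. *)
Definition fresh (x : X) (m : nat) : Prop :=
  forall i, ((i < m)%N : Prop) -> e i x <> e m x.

Lemma fresh_ex x y : C x -> F (x, y) -> exists2 m, e m x = y & fresh x m.
Proof.
move=> Cx /(Ce Cx) [n nP]; have [m mP hm] := @least_nat (fun m => e m x = y) n nP.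
by exists m => // i /hm; rewrite mP.
Qed.

Lemma fresh_inj x m n : fresh x m -> fresh x n -> e m x = e n x -> m = n.
Proof.
move=> hm hn mn; case: (ltngtP m n) => // h; first by case: (hn _ h).
by case: (hm _ h).
Qed.

(** A form of infinitude with countable quantifiers only, hence Borel; see [infinitely_manyP]. *)
Definition infinitely_many (A : set X) (x : X) : Prop :=
  forall N, exists m, (((N <= m)%N : Prop) /\ fresh x m) /\
    (E (x, e m x) /\ A (e m x)).

Lemma borel_fresh (f : X -> X) m : borel_fun f ->
  borel [set x | fresh (f x) m].
Proof.
move=> bf; apply: borel_all => i; apply: borel_imply; first exact: borel_const.
by apply: borel_not; apply: (borel_eq S); exact: borel_fun_comp.
Qed.

Lemma borel_infinitely_many A : borel A -> borel [set x | infinitely_many A x].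
Proof.
move=> bA; apply: borel_all => N; apply: borel_ex => m.
apply: borel_and.
  by apply: borel_and; [exact: borel_const|apply: borel_fresh; exact: borel_id].
apply: borel_and; last exact: borel_comp.
by apply: (borel_pair S) => //; exact: borel_id.
Qed.

Lemma infinitely_manyP A x : C x ->
  (infinitely_many A x <-> infinite_set (eqclass E x `&` A)).
Proof.
move=> Cx; split=> [h|inf N].
  apply: (@unbounded_infinite _ _ (fun y m => e m x = y /\ fresh x m)).
    by move=> y m n [my fm] [ny fn]; apply: (fresh_inj fm fn); rewrite my.
  move=> N; have [m [[Nm fm] [Em Am]]] := h N.
  by exists m, (e m x).
have : finite_set ((fun i => e i x) @` `I_N) by exact: finite_image.
move=> /(infinite_setD inf) /infinite_setN0 [y [[Exy Ay] ny]].
have [m my fm] := fresh_ex Cx (EF Exy).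
exists m; rewrite my; split=> //; split=> //.
by rewrite leqNgt; apply/negP => mN; apply: ny; exists m.
Qed.

Lemma infinitely_many_E A x y : C x -> E (x, y) ->
  infinitely_many A x -> infinitely_many A y.
Proof.
move=> Cx xy /(infinitely_manyP _ Cx) h; apply/infinitely_manyP.
  exact: CE Cx.
by apply: sub_infinite_set h => z [xz Az]; split=> //; apply: Etrans xz; exact: Esym.
Qed.

Definition enum_basic (n : nat) : set X :=
  if unpickle n is Some i then basic i else set0.

Lemma borel_enum_basic n : borel (enum_basic n).
Proof.
by rewrite /enum_basic; case: (unpickle n) => [i|]; [exact: borel_basic|exact: borel0].
Qed.

(* Successively halve every class by a basic open set, keeping an infinite
   half: a decreasing sequence whose intersection meets each class in at most
   one point. *)
Fixpoint marker (n : nat) : set X := if n is m.+1 then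
    [set x | marker m x /\
      ((enum_basic m x -> infinitely_many [set y | marker m y /\ enum_basic m y] x)
      /\ (infinitely_many [set y | marker m y /\ enum_basic m y] x ->
        enum_basic m x))]
  else C.

Lemma borel_marker n : borel (marker n).
Proof.
elim: n => //= n IH.
have bV := borel_enum_basic n.
have bI : borel [set x | infinitely_many [set y | marker n y /\ enum_basic n y] x].
  by apply: borel_infinitely_many; exact: borel_and.
by apply: borel_and => //; apply: borel_and; exact: borel_imply.
Qed.

Lemma marker_le m n x : (m <= n)%N -> marker n x -> marker m x.
Proof.
move=> /subnKC <-; elim: (n - m)%N => [|k IH]; first by rewrite addn0.
by rewrite addnS => -[/IH].
Qed.

Lemma marker_C n x : marker n x -> C x.
Proof. exact: (@marker_le 0%N). Qed.

Lemma marker_infinite n x : C x -> infinite_set (eqclass E x `&` marker n).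
Proof.
elim: n x => [|n IH] x Cx.
  have inf : infinite_set (eqclass E x) by exact: Ea.
  by apply: sub_infinite_set inf => y xy; split=> //; exact: CE Cx.
(* Either the half inside the basic set is infinite and is kept, or only finitely many points are
   discarded. *)
have [iV|niV] :=
  pselect (infinitely_many [set y | marker n y /\ enum_basic n y] x).
  have := iV; move/(infinitely_manyP _ Cx).
  apply: sub_infinite_set => y [xy [my Vy]]; split=> //; split=> //.
  by split=> // _; exact: infinitely_many_E iV.
have fV : finite_set (eqclass E x `&` [set y | marker n y /\ enum_basic n y]).
  by apply: contrapT => /(infinitely_manyP _ Cx).
apply: sub_infinite_set (infinite_setD (IH x Cx) fV) => y [[xy my] ny].
split=> //; split=> //; split=> [Vy|iy]; first by case: ny.
by case: niV; apply: infinitely_many_E iy; [exact: marker_C my|exact: Esym].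
Qed.

(** At the stage of a basic set that contains [x] but not [y], one of the two is discarded. *)
Lemma marker_inj x y : E (x, y) -> (forall n, marker n x) ->
  (forall n, marker n y) -> x = y.
Proof.
move=> xy mx my; apply: contrapT => /(dist_gt0 S) dxy.
have [|i [ix ib]] := basic_nbhs S (open_ball S x (d x y)) (x := x).
  by rewrite /= dist_xx.
have V : enum_basic (pickle i) = basic i by rewrite /enum_basic pickleK.
have [_ [hx _]] := mx (pickle i).+1; have [_ [_ hy]] := my (pickle i).+1.
have /ib /= : basic i y.
  rewrite -V; apply: hy; apply: infinitely_many_E xy (hx _); last by rewrite V.
  exact: marker_C (mx 0%N).
by rewrite ltxx.
Qed.

Definition shell (n : nat) (x : X) : Prop := marker n x /\ ~ marker n.+1 x.

Lemma borel_shell n : borel (shell n).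
Proof.
by apply: borel_and; [|apply: borel_not]; exact: borel_marker.
Qed.

Lemma shell_inj x m n : shell m x -> shell n x -> m = n.
Proof.
move=> [m1 m2] [n1 n2]; case: (ltngtP m n) => // h.
  by case: m2; exact: marker_le n1.
by case: n2; exact: marker_le m1.
Qed.

Lemma shell_ex N x : marker N x -> (exists n, ~ marker n x) ->
  exists2 n, (N <= n)%N & shell n x.
Proof.
move=> mN [k nk]; have [m nm hm] := @least_nat (fun m => ~ marker m x) k nk.
case: m => [|m] in nm hm *; first by case: nm; exact: marker_C mN.
have mm : marker m x by apply: contrapT; exact: hm.
exists m => //; rewrite leqNgt; apply/negP => mN'.
by apply: nm; exact: marker_le mN.
Qed.

Lemma shell_unbounded b N : C b ->
  exists n x, [/\ (N <= n)%N, E (b, x) & shell n x].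
Proof.
move=> Cb; have inf := @marker_infinite N b Cb.
have [x [bx mx]] := infinite_setN0 inf.
have [y [[by_ my] /= yx]] := infinite_setN0 (infinite_setD inf (finite_set1 x)).
have [hx|/existsNP hx] := pselect (forall n, marker n x); last first.
  by have [n Nn sn] := shell_ex mx hx; exists n, x.
have [hy|/existsNP hy] := pselect (forall n, marker n y); last first.
  by have [n Nn sn] := shell_ex my hy; exists n, y.
case: yx; apply: marker_inj => //; apply: Etrans bx; exact: Esym.
Qed.

(** The choice [g n = j] makes [pi] send some point of shell [n] to [e m y]. *)
Definition hits (n j m : nat) (y : X) : Prop := C y /\
  exists l, E (e m y, e l (e m y)) /\ (shell n (e l (e m y)) /\
    e j (e l (e m y)) = e m y).

Lemma borel_hits n j m : borel (hits n j m).
Proof.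
apply: borel_and => //; apply: borel_ex => l; apply: borel_and.
  exact: (borel_pair S).
apply: borel_and; first by apply: borel_comp => //; exact: borel_shell.
by apply: (borel_eq S) => //; apply: borel_fun_comp.
Qed.

Lemma hits_unbounded y m N : C y -> exists n j, (N <= n)%N /\ hits n j m y.
Proof.
move=> Cy; have Cb : C (e m y) by exact: CF Cy.
have [n [x [Nn bx sx]]] := shell_unbounded N Cb.
have [l lx] := Ce Cb (EF bx).
have [j jx] := Ce (CE bx Cb) (EF (Esym bx)).
exists n, j; split=> //; split=> //; exists l; rewrite lx.
by split.
Qed.

(** As [m] varies, [e m y] runs through the whole [F]-class of [y], so every point of the class
    receives an infinite [pi]-fibre. *)
Definition rich (g : nat -> nat) : set X :=
  [set y | C y /\ forall m N, exists n, ((N <= n)%N : Prop) /\ hits n (g n) m y].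

(** Instead of taking [g] generic, the values are chosen one by one. The requirement [(i, m, N)]
    asks for some [n] at least [N] and a basic subset of [basic i] on which [hits n (g n) m] holds
    generically; a single value of [g] meets it. *)
Lemma residual_rich : exists g, residual (rich g).
Proof.
have [D0 rD0 [U oU D0U]] := @borel_baire _ _ S _
  (fun p : nat * nat * nat => hits p.1.1 p.1.2 p.2) (fun p => borel_hits _ _ _).
pose D := D0 `&` C; have rD : residual D by exact: residualI.
have /choice [st stP] : forall q : (nat * nat) * nat * nat, exists p : nat * nat,
    (q.2 <= p.1)%N /\ exists2 k, basic k `<=` basic q.1.1 &
      forall y, D y -> basic k y -> hits p.1 p.2 q.1.2 y.
  move=> [[i m] L] /=.
  have [y iy [D0y Cy]] := residual_dense S rD (basic_open S i) (basic_inh S i).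
  have [n [j [Ln hy]]] := hits_unbounded m L Cy.
  exists (n, j); split=> //=.
  have Uy := (D0U (n, j, m) y D0y).1 hy.
  have [k [ky kU]] := basic_nbhs S (openI (basic_open S i) (oU (n, j, m)))
    (conj iy Uy).
  exists k; first by move=> z /kU [].
  by move=> z [D0z _] /kU [_ Uz]; exact: (D0U (n, j, m) z D0z).2.
(* The bound [L] exceeds all indices used at earlier stages, so no value of [g] is assigned
   twice. *)
pose run k L := if unpickle k is Some (i, m, N) then st (i, m, maxn L N)
  else (L, 0%N).
have runL k L : (L <= (run k L).1)%N.
  rewrite /run; case: (unpickle k) => [[[i m] N]|//].
  by have [/= + _] := stP (i, m, maxn L N); apply: leq_trans; exact: leq_maxl.
pose L := fix L k := if k is k'.+1 then (run k' (L k')).1.+1 else 0%N.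
pose nn k := (run k (L k)).1.
have nnS k : (nn k < nn k.+1)%N by exact: (runL k.+1 (L k.+1)).
have nn_lt k l : (k < l)%N -> (nn k < nn l)%N.
  by apply: (@homo_ltn _ nn _ (fun x y z => @ltn_trans x y z)).
have /choice [g gP] : forall n, exists j, forall k, nn k = n ->
    j = (run k (L k)).2.
  move=> n; have [[k kn]|no] := pselect (exists k, nn k = n); last first.
    by exists 0%N => k kn; case: no; exists k.
  exists (run k (L k)).2 => l ln; suff -> : k = l by [].
  by case: (ltngtP k l) => // /nn_lt; rewrite kn ln ltnn.
exists g.
pose good m N k := exists n, ((N <= n)%N : Prop) /\
  forall y, D y -> basic k y -> hits n (g n) m y.
have gdense i m N : exists2 k, basic k `<=` basic i & good m N k.
  pose k := pickle (i, m, N).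
  have runk : run k (L k) = st (i, m, maxn (L k) N) by rewrite /run pickleK.
  have [/= le [c ci cP]] := stP (i, m, maxn (L k) N).
  exists c => //; exists (nn k); rewrite (gP _ k erefl) /nn runk; split=> //.
  exact: leq_trans (leq_maxr _ _) le.
have rO : residual [set y | forall p : nat * nat, exists k, basic k y /\ good p.1 p.2 k].
  apply: residual_all => -[m N] /=.
  apply: (@residualS _ (\bigcup_(k in good m N) basic k)).
    by move=> y [k gk ky]; exists k.
  apply: residual_open; first by apply: bigcup_open => k _; exact: basic_open.
  move=> O [x Ox] oO; have [i [ix iO]] := basic_nbhs S oO Ox.
  have [k ki gk] := gdense i m N.
  exists (pseq S k.1); split; first by apply/iO/ki; exact: basic_inh.
  by exists k => //; exact: basic_inh.
apply: residualS (residualI rD rO) => y [Dy yO]; split; first exact: Dy.2.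
move=> m N; have [k [ky [n [Nn nP]]]] := yO (m, N).
by exists n; split=> //; exact: nP.
Qed.

Lemma borel_rich g : borel (rich g).
Proof.
apply: borel_and => //; apply: borel_all => m; apply: borel_all => N.
apply: borel_ex => n; apply: borel_and; first exact: borel_const.
exact: borel_hits.
Qed.

Lemma rich_F g x y : F (x, y) -> rich g x -> rich g y.
Proof.
move=> xy [Cx h]; have Cy := CF xy Cx; split=> // m N.
have [k kx] := Ce Cx (Ftrans xy (Fe m y)).
have [n [Nn [_ [l hl]]]] := h k N.
by exists n; split=> //; split=> //; exists l; rewrite -kx.
Qed.

(** * The shift along the fibres of [pi] *)

Section Fibres.
Variable g : nat -> nat.

Lemma base_ex : exists pi : X -> X, [/\ borel_fun pi, forall x, E (x, pi x)
  & forall n x, shell n x -> E (x, e (g n) x) -> pi x = e (g n) x].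
Proof.
pose B n x := shell n x /\ E (x, e (g n) x).
have bB n : borel [set x | B n x].
  apply: borel_and; first exact: borel_shell.
  by apply: (borel_pair S) => //; exact: borel_id.
pose P (o : option nat) : set X :=
  if o is Some n then [set x | B n x] else [set x | ~ exists n, B n x].
have [||N NP bN] := @borel_select _ _ P.
- by case=> [n|]; [exact: bB|apply: borel_not; exact: borel_ex].
- move=> x; have [[n Bn]|no] := pselect (exists n, B n x); last by exists None.
  by exists (Some n).
pose h (o : option nat) := if o is Some n then e (g n) else id.
exists (fun x => h (N x) x); split.
- by apply: borel_fun_select => // -[n|]; [exact: be|exact: borel_id].
- by move=> x; have := NP x; case: (N x) => [n []|_] //=.
move=> n x sn En; have := NP x; case: (N x) => [k [sk _]|no] /=.
  by rewrite (shell_inj sk sn).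
by case: no; exists n.
Qed.

Variable pi : X -> X.
Hypothesis bpi : borel_fun pi.
Hypothesis Epi : forall x, E (x, pi x).
Hypothesis pi_shell :
  forall n x, shell n x -> E (x, e (g n) x) -> pi x = e (g n) x.

Definition in_fibre (b : X) (m : nat) : Prop :=
  fresh b m /\ (E (b, e m b) /\ pi (e m b) = b).

Lemma in_fibre_unbounded b N : rich g b -> exists m, (N <= m)%N /\ in_fibre b m.
Proof.
move=> [Cb h].
suff /(infinitely_manyP _ Cb) /(_ N) [m [[Nm fm] hm]] :
  infinite_set (eqclass E b `&` [set x | pi x = b]) by exists m.
(* Shells are disjoint, so fibre points in arbitrarily late shells are infinitely many. *)
apply: (@unbounded_infinite _ _ (fun x n => shell n x)).
  by move=> x m n; exact: shell_inj.
move=> M; have [m mb] := Ce Cb (Frefl b).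
have [n [Mn [_ [l]]]] := h m M; rewrite mb => -[bl [sl jl]].
exists n, (e l b); split=> //; split=> //=.
by rewrite (pi_shell sl) jl//; exact: Esym.
Qed.

Lemma borel_in_fibre m : borel [set y | in_fibre (pi y) m].
Proof.
apply: borel_and; first exact: borel_fresh.
have bem : borel_fun (fun y => e m (pi y)) by exact: borel_fun_comp.
apply: borel_and; first exact: (borel_pair S).
by apply: (borel_eq S) => //; exact: borel_fun_comp.
Qed.

(* [m] is the index of [y] in the fibre of its base, and [n] the next one. *)
Definition next_index (m n : nat) (y : X) : Prop :=
  (e m (pi y) = y /\ in_fibre (pi y) m) /\
  (in_fibre (pi y) n /\ (((m < n)%N : Prop) /\
    forall k, ((m < k < n)%N : Prop) -> ~ in_fibre (pi y) k)).

Lemma borel_next_index m n : borel (next_index m n).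
Proof.
apply: borel_and; apply: borel_and; try exact: borel_in_fibre.
  by apply: (borel_eq S); [exact: borel_fun_comp|exact: borel_id].
apply: borel_and; first exact: borel_const.
apply: borel_all => k; apply: borel_imply; first exact: borel_const.
by apply: borel_not; exact: borel_in_fibre.
Qed.

Lemma next_index_ex y : rich g y -> exists m n, next_index m n y.
Proof.
move=> ry; have rb : rich g (pi y) by apply: rich_F ry; exact/EF.
have Eb := Esym (Epi y).
have [m my fm] := fresh_ex rb.1 (EF Eb).
have [n0 [mn0 n0P]] := in_fibre_unbounded m.+1 rb.
have [n [mn nP] hn] := @least_nat
  (fun k => (m < k)%N /\ in_fibre (pi y) k) n0 (conj mn0 n0P).
exists m, n; split; first by split=> //; split=> //; rewrite my.
split=> //; split=> // k /andP [mk kn] kP.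
by apply: (hn k).
Qed.

Lemma shift_ex : exists T : X -> X, borel_fun T /\ forall y, rich g y ->
  exists m n, next_index m n y /\ T y = e n (pi y).
Proof.
pose P (o : option (nat * nat)) : set X := if o is Some p
  then next_index p.1 p.2 else [set y | ~ exists p, next_index p.1 p.2 y].
have bn (p : nat * nat) : borel (next_index p.1 p.2) by exact: borel_next_index.
have [||N NP bN] := @borel_select _ _ P.
- by case=> [p|]; [exact: bn|apply: borel_not; exact: borel_ex].
- move=> y; have [[p Pp]|no] := pselect (exists p, next_index p.1 p.2 y);
    last by exists None.
  by exists (Some p).
pose h (o : option (nat * nat)) (y : X) := if o is Some p then e p.2 (pi y) else y.
exists (fun x => h (N x) x); split.
  apply: borel_fun_select => // -[p|]; last exact: borel_id.
  exact: borel_fun_comp.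
move=> y /next_index_ex [m [n mn]]; have := NP y; case: (N y) => [p pP|no].
  by exists p.1, p.2.
by case: no; exists (m, n).
Qed.

Variable T : X -> X.
Hypothesis Tnext : forall y, rich g y ->
  exists m n, next_index m n y /\ T y = e n (pi y).

Lemma shift_E y : rich g y -> E (y, T y).
Proof.
by move=> /Tnext [m [n [[_ [[_ [En _]] _]] ->]]]; exact: Etrans (Epi y) En.
Qed.

Lemma shift_pi y : rich g y -> pi (T y) = pi y.
Proof. by move=> /Tnext [m [n [[_ [[_ [_ pn]] _]] ->]]]. Qed.

(** The shift preserves the base, and of two different predecessors of one index the larger would
    lie strictly between the other and that index. *)
Lemma shift_inj y z : rich g y -> rich g z -> T y = T z -> y = z.
Proof.
move=> ry rz Tyz; have pyz : pi y = pi z by rewrite -shift_pi// Tyz shift_pi.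
have [m [n [[[my mP] [nP [mn hn]]] Ty]]] := Tnext ry.
have [m' [n' [[[mz mP'] [nP' [mn' hn']]] Tz]]] := Tnext rz.
rewrite -pyz in mz mP' nP' hn' Tz.
have nn' : n = n' by apply: (fresh_inj nP.1 nP'.1); rewrite -Ty -Tz.
rewrite -nn' in mn' hn'.
suff mm' : m = m' by rewrite -my -mz mm'.
case: (ltngtP m m') => // h; first by case: (hn m') => //; rewrite h.
by case: (hn' m) => //; rewrite h.
Qed.

(** The first point of the fibre over [y] itself is in the class of [y] and has no predecessor. *)
Lemma shift_not_onto y : rich g y ->
  exists2 z, E (y, z) & forall x, rich g x -> T x <> z.
Proof.
move=> ry; have [k0 [_ k0P]] := in_fibre_unbounded 0%N ry.
have [k kP hk] := @least_nat (in_fibre y) k0 k0P.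
exists (e k y); first by case: kP => _ [].
move=> x rx Tx; have pxy : pi x = y.
  by rewrite -(shift_pi rx) Tx; case: kP => _ [].
have [m [n [[[_ mP] [nP [mn _]]] Tn]]] := Tnext rx.
rewrite pxy in mP nP Tn.
have nk : n = k by apply: (fresh_inj nP.1 kP.1); rewrite -Tn.
by apply: (hk m) => //; rewrite -nk.
Qed.

End Fibres.

Lemma generic_compression : exists C' : set X, exists T : X -> X,
  [/\ borel C', residual C', forall x y, F (x, y) -> C' x -> C' y & borel_fun T]
  /\ [/\ forall y, C' y -> E (y, T y),
    forall y z, C' y -> C' z -> T y = T z -> y = z
  & forall y, C' y -> exists2 z, E (y, z) & forall x, C' x -> T x <> z].
Proof.
have [g rg] := residual_rich; have [pi [bpi Epi pi_shell]] := base_ex g.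
have [T [bT Tnext]] := shift_ex bpi Epi pi_shell.
exists (rich g), T; split; split=> //.
- exact: borel_rich.
- exact: rich_F.
- by move=> y; exact: (shift_E Epi Tnext).
- by move=> y z; exact: (shift_inj Tnext).
- by move=> y; exact: (shift_not_onto pi_shell Tnext).
Qed.

End GenericCompression.

(** * Borel sets of subspaces, and the conclusion *)

Section Restriction.
Variables (X : topologicalType) (C : set X).

Lemma borel_set_val : borel_fun (set_val : set_type C -> X).
Proof.
apply: borel_fun_open => O oO; apply: borel_open; apply: open_comp => // x _.
exact: initial_continuous.
Qed.

Lemma borel_trace (B : set (set_type C)) : borel B ->
  exists2 A : set X, borel A & B = set_val @^-1` A.
Proof.
apply: (smallest_sub _ _ (X := [set B | exists2 A : set X, borel A &
  B = set_val @^-1` A])).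
  split=> /=.
  - by exists set0; [exact: borel0|rewrite preimage_set0].
  - move=> A [A' bA ->]; exists (~` A'); first exact: borel_not.
    by rewrite setTD preimage_setC.
  - move=> G /(_ _)/cid2-/all_sig2 [A bA GA].
    exists (\bigcup_n A n); first exact: borel_bigcup.
    by rewrite preimage_bigcup; apply: eq_bigcup => // n _; exact: GA.
by move=> O [A oA <-]; exists A => //; exact: borel_open.
Qed.

End Restriction.

Theorem theorem3p10 (R : realType) (X : topologicalType)
    (polX : polish_space R X) (E F : set (X * X))
    (cberE : cber E) (cberF : cber F)
    (aperE : aperiodic E) (aperF : aperiodic F) (EF : E `<=` F) :
  exists C : set X,
    [/\ comeager C, invariant_set F C, borel C & compressible (restriction E C)].
Proof.
(* A dense sequence requires a point, so the empty space is treated apart. *)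
have [[x0 _]|empty] := pselect (exists x : X, True); last first.
  exists set0; split.
  - exists (fun=> set0); first by move=> n; rewrite /nowhere_dense closure0 interior0.
    by apply/seteqP; split=> x; case: empty; exists x.
  - by exists set0; rewrite bigcup_set0.
  - exact: borel0.
  - exists id; split=> // y; case: empty; exists (set_val y); exact: I.
have [S] := polish_data_exists x0 polX.
have [bE eE cE] := cberE; have [bF eF cF] := cberF.
have [C1 [e [[bC1 rC1 C1F] [be Fe Ce]]]] := invariant_enumeration S eF cF bF.
have [C [T [[bC rC CF bT] [ET Tinj Tno]]]] :=
  generic_compression S bE eE aperE eF EF bC1 rC1 C1F be Fe Ce.
have TC y : C y -> C (T y) by move=> Cy; apply: CF (Cy); apply: EF; exact: ET.
have valC (y : set_type C) : C (set_val y) by exact: set_valP.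
exists C; split=> //.
- exact: residual_comeager.
- exists C; apply/seteqP; split=> x; last by move=> [y Cy] /CF; exact.
  by move=> Cx; exists x => //; case: eF => h _ _; exact: h.
pose T' (y : set_type C) : set_type C := SigSub (mem_set (TC _ (valC y))).
exists T'; split.
- move=> B /borel_trace [A bA ->].
  by rewrite -comp_preimage; exact: (borel_set_val (bT A bA)).
- move=> y z /(congr1 set_val) /= /Tinj h; apply: val_inj; exact: h.
move=> y; split=> [_ [z yz <-]|sub].
  case: eE => _ _ Etrans; apply: Etrans yz _; exact: ET.
(* The point missed by [T] is in [C] by invariance, so the restricted map misses it too. *)
have [z yz zT] := Tno _ (valC y).
have Cz : C z by apply: CF (valC y); exact: EF.
have [|x _ xz] := sub (SigSub (mem_set Cz)); first exact: yz.
apply: (zT _ (valC x)); have := congr1 set_val xz.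
by [].
Qed.
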